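(* Let $u$ be an inner function and let $f=f_1+uf_2$ with $f_1,f_2\in K_u$. For $w\in\mathbb D$, set $Tf(w)=\langle f,k_{u,w}^2\rangle$. Then for every $w\in\mathbb D$, $$Tf(w)=\langle f,k_{u,w}^2\rangle=(zf)'(w)-2u(w)(zf_2)'(w).$$
   Context: $\mathbb D$ is the open unit disk, $H^2$ is the Hardy space of $\mathbb D$ with inner product $\langle\cdot,\cdot\rangle$ (that of $L^2(\partial\mathbb D)$, normalized arc length). $K_u=H^2\ominus uH^2$, whose reproducing kernel at $w\in\mathbb D$ is $k_{u,w}(z)=\frac{1-\overline{u(w)}u(z)}{1-\overline w z}$. For holomorphic $g$ on $\mathbb D$, $(zg)'(w)$ denotes the derivative of $z\mapsto zg(z)$ at $w$. *)

(* Defs.v *)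
From HB Require Import structures.
From mathcomp Require Export all_boot all_order all_algebra.
From mathcomp Require Export all_classical all_reals all_analysis.
From mathcomp Require Export complex.
Set Implicit Arguments.
Unset Strict Implicit.
Unset Printing Implicit Defensive.
Export Order.TTheory GRing.Theory Num.Theory.
Export numFieldNormedType.Exports.

Local Open Scope classical_set_scope.
Local Open Scope ring_scope.

(* R[i] as a normed module over itself, following the pattern of
   numFieldNormedType, which only covers abstract field structures. *)
HB.instance Definition _ (R : rcfType) := GRing.ComAlgebra.copy R[i] R[i]^o.
HB.instance Definition _ (R : rcfType) := Vector.copy R[i] R[i]^o.
HB.instance Definition _ (R : rcfType) := NormedModule.copy R[i] R[i]^o.

Section Hardy.
Variable R : realType.
Implicit Types (f g u : R[i] -> R[i]) (w z : R[i]) (r t : R).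

(* A function on the open unit disk is represented by a total function on R[i];
   no definition below depends on its values at points z with 1 <= `|z|. *)
Definition disk : set R[i] := [set z | `|z| < 1].

(* Taylor series at 0 with square-summable coefficients, converging to f
   throughout the disk; in particular f is holomorphic there. *)
Definition hardy2 f : Prop :=
  exists2 a : nat -> R[i], cvgn [series `|a n| ^+ 2]_n &
    forall z, disk z -> [series a n * z ^+ n]_n @ \oo --> f z.

(* the point r e^{it} *)
Definition polar r t : R[i] := Complex (r * cos t) (r * sin t).

(* The boundary function t |-> f(e^{it}), as a radial limit; by Fatou's theorem
   the limit exists for almost every t when f belongs to H^2. *)
Definition boundary f t : R[i] := lim (f (polar r t) @[r --> (1 : R)^'-]).

(* integral over the unit circle for normalized arc length dt / (2 pi) *)
Definition circle_integral (F : R -> R[i]) : R[i] :=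
  Complex
    ((2 * pi)^-1 * \int[lebesgue_measure]_(t in `[0, 2 * pi]) complex.Re (F t))
    ((2 * pi)^-1 * \int[lebesgue_measure]_(t in `[0, 2 * pi]) complex.Im (F t)).

(* inner product of L^2 of the unit circle, conjugate-linear in g *)
Definition inner_prod f g : R[i] :=
  circle_integral (fun t => boundary f t * (boundary g t)^*).

(* H^infty is the set of bounded elements of H^2. *)
Definition inner_function u : Prop :=
  [/\ hardy2 u,
      exists M : R[i], forall z, disk z -> `|u z| <= M &
      {ae (@lebesgue_measure R), forall t,
        exists2 l : R[i], u (polar r t) @[r --> (1 : R)^'-] --> l & `|l| = 1}].

(* K_u, the orthogonal complement of u H^2 in H^2 *)
Definition model_space u : set (R[i] -> R[i]) :=
  [set f | hardy2 f /\
    forall g, hardy2 g -> inner_prod f (fun z => u z * g z) = 0].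

(* reproducing kernel of K_u at w *)
Definition model_kernel u w z : R[i] :=
  (1 - (u w)^* * u z) / (1 - w^* * z).

Definition T_op u f w : R[i] :=
  inner_prod f (fun z => model_kernel u w z ^+ 2).

End Hardy.

(* Main.v *)
Require Import Defs.
From mathcomp Require Import measurable_realfun ring lra zify.
Set Implicit Arguments.
Unset Strict Implicit.
Unset Printing Implicit Defensive.
Local Open Scope classical_set_scope.
Local Open Scope ring_scope.

(* On the unit circle |u| = 1, so that with h = 1 / (1 - conj w z)^2 the pairing
   of f1 + u f2 with k^2 = (1 - conj (u w) u)^2 h expands into <f1, h>, <u f2, h>,
   - 2 u(w) <f2, h> and multiples of <f1, u h>, <f1, u^2 h>, <f2, u h>; the last
   three vanish because f1 and f2 are orthogonal to u H^2. Since h has the Taylor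
   coefficients (n + 1) conj w^n, pairing with h is g |-> (z g)'(w).

   The inner product is an integral of radial limits, so this needs Fatou's
   theorem on H^2. The partial sums of the Taylor series converge in L^1 of the
   circle along a fast subsequence to some F (Riesz-Fischer); the function on the
   disk is the Poisson integral of F, hence tends radially to F at each Lebesgue
   point of F. *)

(** The boundary function of an H^2 function is available only as an L^1 limit of partial sums, and
    this shapes the computation: a pairing is evaluated by passing to the limit against a bounded
    factor, either [X], the conjugate of the boundary function of [h], or [X * U] with [U] the
    boundary function of [u]. Hence the Taylor series of [u f2] is never formed: in [<u f2, h>] the
    series of [f2] is expanded, and each monomial times [u] is paired with [h] separately. Fast
    tails make the L^1 norms of the increments summable, which supplies an integrable dominating
    function. Orthogonality to [u H^2] is tested on [h] and on [u h]; this is why H^2 must be closed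
    under division by [1 - c z] for [c] in the disk. The surviving pairings are [(z f1)'(w)],
    [(z u f2)'(w)] and [(z f2)'(w)], the last with coefficient [- 2 u(w)]; the first two add up to
    [(z f)'(w)]. Integrals of the Poisson and Szego kernels come from recurrences whose bounded
    solutions are unique, in place of series summed under the integral. *)

Local Notation Re := complex.Re.
Local Notation Im := complex.Im.

(** * Trigonometric integrals *)

Section trigonometric_integrals.
Context {R : realType}.
Local Notation mu := (@lebesgue_measure R).
Local Notation period := (`[0 : R, 2 * pi]%classic).
Implicit Types (f g : R -> R) (c r s t : R) (n m : nat).

Lemma continuous_integrable_period f : continuous f ->
  mu.-integrable period (EFin \o f).
Proof.
move=> cf; apply: continuous_compact_integrable; first exact: segment_compact.
exact: continuous_subspaceT.
Qed.

Lemma measure_period : mu period = (2 * pi)%:E.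
Proof. 
by rewrite lebesgue_measure_itv/= lte_fin mulr_gt0 ?pi_gt0// -EFinB subr0.
Qed.

Lemma continuous_cos_affine (k c : R) : continuous (fun t => cos (k * t + c)).
Proof.
move=> t; apply: continuous_comp; last exact: continuous_cos.
by apply: cvgD; [apply: cvgM; [exact: cvg_cst|exact: cvg_id]|exact: cvg_cst].
Qed.

Lemma cos_nat_period n c : cos (n%:R * (2 * pi) + c) = cos c :> R.
Proof.
rewrite addrC mulr_natl mulr_natl.
exact: (periodicn (@cosD2pi R)).
Qed.

Lemma Rintegral_cos_nat n c : (0 < n)%N ->
  \int[mu]_(t in period) cos (n%:R * t + c) = 0.
Proof.
move=> n0; rewrite /Rintegral.
have nn0 : n%:R != 0 :> R by rewrite pnatr_eq0 -lt0n.
(* The antiderivative [sin / n] is written as a shifted cosine, so that [cos_nat_period] and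
   [continuous_cos_affine] apply to it. *)
pose F t : R := n%:R^-1 * cos (n%:R * t + (c - pi / 2)).
have FE t : F t = n%:R^-1 * sin (n%:R * t + c).
  by rewrite /F addrA cosBpihalf.
have dF t : is_derive t 1 F (cos (n%:R * t + c)).
  rewrite (_ : F = fun t => n%:R^-1 * sin (n%:R * t + c)); last exact/funext.
  apply: is_derive_eq.
  by rewrite /GRing.scale /=; field.
have cF : continuous F.
  move=> t; apply: cvgM; [exact: cvg_cst|exact: continuous_cos_affine].
rewrite (@continuous_FTC2 _ _ F).
- by rewrite /F cos_nat_period mulr0 add0r -EFinB subrr.
- by rewrite mulr_gt0 ?pi_gt0.
- exact/continuous_subspaceT/continuous_cos_affine.
- split=> [t _||].
  + exact: ex_derive.
  + exact/cvg_at_right_filter/cF.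
  + exact/cvg_at_left_filter/cF.
- by move=> t _; rewrite derive1E derive_val.
Qed.

Lemma RintegralD_period f g : continuous f -> continuous g ->
  \int[mu]_(t in period) (f t + g t) =
  \int[mu]_(t in period) f t + \int[mu]_(t in period) g t.
Proof. by move=> cf cg; rewrite RintegralD//; exact: continuous_integrable_period. Qed.

Lemma RintegralZ_period k f : continuous f ->
  \int[mu]_(t in period) (k * f t) = k * \int[mu]_(t in period) f t.
Proof. by move=> cf; rewrite RintegralZl//; exact: continuous_integrable_period. Qed.

Lemma continuous_sum_nat (F : nat -> R -> R) N M :
  (forall n, continuous (F n)) -> continuous (fun t => \sum_(N <= n < M) F n t).
Proof.
move=> cF t; elim: M => [|M IH].
  by under eq_fun do rewrite big_nil; exact: cvg_cst.
have [NM|NM] := leqP N M; last first.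
  by under eq_fun do rewrite big_geq//; exact: cvg_cst.
under eq_fun do rewrite big_nat_recr//=.
by apply: cvgD => //; exact: cF.
Qed.

Lemma Rintegral_sum_period (F : nat -> R -> R) N M :
  (forall n, continuous (F n)) ->
  \int[mu]_(t in period) (\sum_(N <= n < M) F n t) =
  \sum_(N <= n < M) \int[mu]_(t in period) F n t.
Proof.
move=> cF; elim: M => [|M IH].
  by under eq_Rintegral do rewrite big_nil; rewrite Rintegral_cst// mul0r big_nil.
have [NM|NM] := leqP N M; last first.
  rewrite big_geq//; under eq_Rintegral do rewrite big_geq//.
  by rewrite Rintegral_cst// mul0r.
under eq_Rintegral do rewrite big_nat_recr//=.
by rewrite RintegralD_period ?big_nat_recr//= ?IH//; exact: continuous_sum_nat.
Qed.

Lemma cosMcos (a b : R) : cos a * cos b = 2^-1 * (cos (a + b) + cos (a - b)).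
Proof. by rewrite cosD cosB; field. Qed.

(** Product-to-sum leaves the frequencies [n + m] and [n - m], both nonzero. The free phases let
    this one statement cover sines too, as cosines shifted by [- (pi / 2)]. *)
Lemma Rintegral_cosMcos n m c d : n != m ->
  \int[mu]_(t in period) (cos (n%:R * t + c) * cos (m%:R * t + d)) = 0.
Proof.
wlog nm : n m c d / (m < n)%N.
  move=> h; have [nm _|mn _|//] := ltngtP n m; last first.
    by apply: h; rewrite ?gtn_eqF.
  under eq_Rintegral do rewrite mulrC.
  by apply: h; rewrite ?gtn_eqF.
move=> _; have Heq t : cos (n%:R * t + c) * cos (m%:R * t + d) =
  2^-1 * (cos ((n + m)%:R * t + (c + d)) + cos ((n - m)%:R * t + (c - d))).
  by rewrite cosMcos natrD (natrB _ (ltnW nm)); congr (_ * (cos _ + cos _)); ring.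
under eq_Rintegral do rewrite Heq.
rewrite RintegralZ_period; last first.
  by move=> t; apply: cvgD; exact: continuous_cos_affine.
rewrite RintegralD_period; [|exact: continuous_cos_affine..].
by rewrite !Rintegral_cos_nat ?subn_gt0// ?addn_gt0 ?(leq_trans _ nm)// addr0 mulr0.
Qed.

(** * Trigonometric polynomials and their mean squares *)

Section waves.
Variables al be : nat -> R.

(** Common shape of the real and the imaginary part of [a n * e^{int}]: the pair [al, be] is
    [Re a, - Im a] for the former and [Im a, Re a] for the latter. *)
Definition wave n t : R := al n * cos (n%:R * t) + be n * sin (n%:R * t).

Lemma waveE n t :
  wave n t = al n * cos (n%:R * t + 0) + be n * cos (n%:R * t + - (pi / 2)).
Proof. by rewrite /wave addr0 cosBpihalf. Qed.

Lemma continuous_wave n : continuous (wave n).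
Proof.
rewrite (funext (waveE n)) => t.
by apply: cvgD; apply: cvgM; [exact: cvg_cst|exact: continuous_cos_affine
  |exact: cvg_cst|exact: continuous_cos_affine].
Qed.

(** The difference of the two sides is the square of [al n * sin - be n * cos]. This pointwise bound
    stands in for the integrals of [cos ^+ 2] and [sin ^+ 2], at the cost of a constant factor. *)
Lemma wave_sqr_le n t : wave n t ^+ 2 <= al n ^+ 2 + be n ^+ 2.
Proof.
have h := cos2Dsin2 (n%:R * t).
rewrite /wave; set c := cos _ in h *; set s := sin _ in h *.
have : 0 <= (al n * s - be n * c) ^+ 2 by exact: sqr_ge0.
have -> : al n ^+ 2 + be n ^+ 2 = (al n ^+ 2 + be n ^+ 2) * (c ^+ 2 + s ^+ 2).
  by rewrite h mulr1.
nra.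
Qed.

Lemma Rintegral_waveM n m : n != m ->
  \int[mu]_(t in period) (wave n t * wave m t) = 0.
Proof.
move=> nm.
pose F p q t : R := p * q * (cos (n%:R * t + 0) * cos (m%:R * t + 0)).
have c0 p n1 c1 m1 d1 : continuous
  (fun t => p * (cos (n1%:R * t + c1) * cos (m1%:R * t + d1)) : R).
  by move=> t; apply: cvgM; [exact: cvg_cst|apply: cvgM; exact: continuous_cos_affine].
have Heq t : wave n t * wave m t =
  al n * al m * (cos (n%:R * t + 0) * cos (m%:R * t + 0)) +
  al n * be m * (cos (n%:R * t + 0) * cos (m%:R * t + - (pi / 2))) +
  (be n * al m * (cos (n%:R * t + - (pi / 2)) * cos (m%:R * t + 0)) +
  be n * be m * (cos (n%:R * t + - (pi / 2)) * cos (m%:R * t + - (pi / 2)))).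
  by rewrite !waveE; ring.
have c1 c2 d2 : continuous
  (fun t => cos (n%:R * t + c2) * cos (m%:R * t + d2) : R).
  by move=> t; apply: cvgM; exact: continuous_cos_affine.
under eq_Rintegral do rewrite Heq.
rewrite !RintegralD_period ?RintegralZ_period;
  do ?[by move=> t; apply: cvgD; exact: c0|exact: c0|exact: c1].
by rewrite !Rintegral_cosMcos//; ring.
Qed.

Definition tpoly N M t : R := \sum_(N <= n < M) wave n t.

Lemma continuous_tpoly N M : continuous (tpoly N M).
Proof. by apply: continuous_sum_nat => n; exact: continuous_wave. Qed.

(** Bessel-type bound: the cross terms integrate to 0 and each diagonal term is bounded pointwise.
    It measures the blocks between consecutive indices of a fast subsequence. *)
Lemma Rintegral_tpoly_sqr N M :
  \int[mu]_(t in period) (tpoly N M t ^+ 2) <=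
  2 * pi * \sum_(N <= n < M) (al n ^+ 2 + be n ^+ 2).
Proof.
have cw := continuous_wave.
have cM f g : continuous f -> continuous g -> continuous (fun t => f t * g t).
  by move=> cf cg t; apply: cvgM; [exact: cf|exact: cg].
elim: M => [|M IH].
  rewrite big_nil mulr0; under eq_Rintegral do rewrite /tpoly big_nil expr0n/=.
  by rewrite Rintegral_cst// mul0r.
have [NM|NM] := leqP N M; last first.
  rewrite big_geq// mulr0; under eq_Rintegral do rewrite /tpoly big_geq// expr0n/=.
  by rewrite Rintegral_cst// mul0r.
rewrite big_nat_recr//= (mulrDr (2 * pi)).
have Heq t : tpoly N M.+1 t ^+ 2 = tpoly N M t ^+ 2 +
    (2 * \sum_(N <= n < M) (wave n t * wave M t) + wave M t * wave M t).
  by rewrite /tpoly big_nat_recr//= -mulr_suml; ring.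
under eq_Rintegral do rewrite Heq.
have c1 : continuous (fun t => \sum_(N <= n < M) (wave n t * wave M t)).
  by apply: continuous_sum_nat => n; exact: cM.
have c2 : continuous (fun t => tpoly N M t ^+ 2).
  by apply: (cM (tpoly N M)); exact: continuous_tpoly.
have c3 : continuous (fun t => wave M t * wave M t) by exact: cM.
have c4 : continuous (fun t => 2 * \sum_(N <= n < M) (wave n t * wave M t)).
  by apply: (cM (cst 2)) => // t; exact: cvg_cst.
rewrite RintegralD_period//; last by move=> t; apply: cvgD; [exact: c4|exact: c3].
rewrite RintegralD_period// RintegralZ_period//.
apply: lerD => //.
rewrite Rintegral_sum_period => [|n]; last exact: cM.
rewrite big_nat_cond big1 ?mulr0 ?add0r => [|n /andP[/andP[_ nM] _]]; last first.
  by rewrite Rintegral_waveM// ltn_eqF.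
have -> : 2 * pi * (al M ^+ 2 + be M ^+ 2) =
    \int[mu]_(t in period) (al M ^+ 2 + be M ^+ 2).
  by rewrite Rintegral_cst//= measure_period/= mulrC.
apply: le_Rintegral => //; first exact: continuous_integrable_period.
- by apply: continuous_integrable_period => t; exact: cvg_cst.
- by move=> t _; rewrite -expr2 wave_sqr_le.
Qed.

End waves.
End trigonometric_integrals.

(** Iterating the relation gives [D n = r ^+ k * D (n + k)], which tends to 0 in [k] for bounded
    [D]. This replaces the summation of a geometric series for both the Poisson and the Szego
    kernel. *)
Lemma geometric_decay_eq0 (R : realType) (r B : R) (D : nat -> R) :
  0 <= r -> r < 1 -> (forall n, `|D n| <= B) -> (forall n, D n = r * D n.+1) ->
  forall n, D n = 0.
Proof.
move=> r0 r1 DB Dr n.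
have Dk k : D n = r ^+ k * D (n + k)%N.
  by elim: k => [|k ->]; rewrite ?expr0 ?mul1r ?addn0// Dr addnS exprSr mulrA.
apply/normr0_eq0/eqP; rewrite eq_le normr_ge0 andbT.
have : (fun k => r ^+ k * B) @ \oo --> 0 * B.
  by apply: cvgM; [apply: cvg_expr; rewrite ger0_norm|exact: cvg_cst].
rewrite mul0r => rB; rewrite -(cvg_lim _ rB)//.
apply: limr_ge; first by apply/cvg_ex; exists 0.
apply: nearW => k; rewrite (Dk k) normrM ger0_norm ?exprn_ge0//.
by rewrite ler_wpM2l ?exprn_ge0.
Qed.

(** * The Poisson kernel *)

Section poisson_kernel.
Context {R : realType}.
Local Notation mu := (@lebesgue_measure R).
Local Notation period := (`[0 : R, 2 * pi]%classic).
Implicit Types (c r s t : R) (n m : nat).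

(** Closed form of the sum of [r ^ |n| * e^{int}] over all integers [n], without the factor
    [1 / (2 pi)]. *)
Definition poisson r t : R := (1 - r ^+ 2) / (1 - 2 * r * cos t + r ^+ 2).

Lemma poisson_den_ge r t : 0 <= r -> (1 - r) ^+ 2 <= 1 - 2 * r * cos t + r ^+ 2.
Proof. by move=> r0; have := cos_le1 t; nra. Qed.

Lemma poisson_den_gt0 r t : 0 <= r -> r < 1 -> 0 < 1 - 2 * r * cos t + r ^+ 2.
Proof.
move=> r0 r1; apply: lt_le_trans (poisson_den_ge t r0).
by rewrite exprn_gt0// subr_gt0.
Qed.

Lemma poisson_ge0 r t : 0 <= r -> r < 1 -> 0 <= poisson r t.
Proof.
move=> r0 r1; rewrite divr_ge0//; last exact/ltW/poisson_den_gt0.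
by rewrite subr_ge0 expr_le1// ltW.
Qed.

(** This is [(1 + r ^+ 2 - 2 * r * cos x) * poisson r x = 1 - r ^+ 2] multiplied by [cos b], with
    [2 * cos x * cos b] turned into a sum. *)
Lemma poisson_cos_rec r x b : 0 <= r -> r < 1 ->
  (1 + r ^+ 2) * (poisson r x * cos b) +
  (- r * (poisson r x * cos (b + x)) + - r * (poisson r x * cos (b - x))) =
  (1 - r ^+ 2) * cos b.
Proof.
move=> r0 r1; have /lt0r_neq0 dn0 := poisson_den_gt0 x r0 r1.
by rewrite cosD cosB /poisson; field.
Qed.

Lemma continuous_poisson r t : 0 <= r -> r < 1 ->
  continuous (fun s => poisson r (s - t)).
Proof.
move=> r0 r1 s; apply: cvgM; first exact: cvg_cst.
apply: cvgV; first by rewrite gt_eqF// poisson_den_gt0.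
apply: cvgD; last exact: cvg_cst.
apply: cvgB; first exact: cvg_cst.
apply: cvgM; first exact: cvg_cst.
apply: (@continuous_comp _ _ _ (fun s => s - t) cos); last exact: continuous_cos.
by apply: cvgB; [exact: cvg_id|exact: cvg_cst].
Qed.

(** * Cosine moments of the Poisson kernel *)

Section moments.
Variables (r t : R).
Hypotheses (r0 : 0 <= r) (r1 : r < 1).

Let F n c s : R := poisson r (s - t) * cos (n%:R * (s - t) + c).
Let J n c : R := \int[mu]_(s in period) F n c s.

Let cF n c : continuous (F n c).
Proof.
move=> s; apply: cvgM; first exact: continuous_poisson.
apply: (@continuous_comp _ _ _ (fun s => s - t) (fun x => cos (n%:R * x + c))).
  by apply: cvgB; [exact: cvg_id|exact: cvg_cst].
exact: continuous_cos_affine.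
Qed.

Let FZ k n c : continuous (fun s => k * F n c s).
Proof. by move=> s; apply: cvgM; [exact: cvg_cst|exact: cF]. Qed.

Let J_rec n c : (1 + r ^+ 2) * J n.+1 c - r * (J n.+2 c + J n c) = 0.
Proof.
(* With [b = n.+1 * (s - t) + c] the right-hand side of [poisson_cos_rec] is a cosine of positive
   frequency in [s], of mean zero. *)
have <- : \int[mu]_(s in period)
    ((1 - r ^+ 2) * cos (n.+1%:R * s + (c - n.+1%:R * t))) = 0.
  by rewrite RintegralZ_period ?Rintegral_cos_nat ?mulr0//; exact: continuous_cos_affine.
transitivity (\int[mu]_(s in period) ((1 + r ^+ 2) * F n.+1 c s +
    (- r * F n.+2 c s + - r * F n c s))).
  rewrite !RintegralD_period; [|exact: FZ|exact: FZ|exact: FZ|]; last first.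
    by move=> s; apply: cvgD; exact: FZ.
  by rewrite !RintegralZ_period//; rewrite /J; ring.
apply: eq_Rintegral => s _.
rewrite -[RHS](_ : (1 - r ^+ 2) * cos (n.+1%:R * (s - t) + c) = _); last first.
  by congr (_ * cos _); ring.
rewrite -(poisson_cos_rec (s - t) _ r0 r1) /F.
by congr (_ + (_ * (_ * cos _) + _ * (_ * cos _))); rewrite -!natr1; ring.
Qed.

Let J_bound n c : `|J n c| <= \int[mu]_(s in period) poisson r (s - t).
Proof.
have iF := continuous_integrable_period (@cF n c).
apply: le_trans (le_normr_Rintegral _ iF) _ => //.
apply: le_Rintegral => //.
- by apply: continuous_integrable_period => s; apply: cvg_norm; exact: cF.
- exact/continuous_integrable_period/continuous_poisson.
- move=> s _; rewrite /F normrM ger0_norm ?poisson_ge0// ler_piMr ?poisson_ge0//.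
  exact: cos_max.
Qed.

(* The recurrence says that [D n = J n.+1 - r * J n] satisfies [D n = r * D n.+1];
   as [D] is bounded it vanishes, which excludes the solution [r ^- n]. *)
Let J_geo n c : J n c = r ^+ n * J 0 c.
Proof.
have JS m : J m.+1 c - r * J m c = 0.
  pose B := \int[mu]_(s in period) poisson r (s - t).
  apply: (@geometric_decay_eq0 _ r (2 * B) (fun m => J m.+1 c - r * J m c)) => //.
  - move=> k; apply: le_trans (ler_normB _ _) _.
    rewrite mulr_natl mulr2n lerD// normrM ger0_norm//.
    by apply: le_trans (J_bound k c); rewrite ler_piMl// ltW.
  - by move=> k; have := J_rec k c; lra.
elim: n => [|n IH]; first by rewrite mul1r.
by have /eqP := JS n; rewrite subr_eq0 => /eqP ->; rewrite IH exprS mulrA.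
Qed.

Let J0 c : J 0 c = 2 * pi * cos c.
Proof.
(* At frequency 0 the term in [b - x] has frequency -1, that is, frequency 1 with phase [- d]. The
   equations for [d = c] and [d = - c] have the same right-hand side, which forces
   [J 0 c = J 0 (- c)] and closes the system. *)
have E d : (1 + r ^+ 2) * J 0 d - r * (J 1 d + J 1 (- d)) =
    (1 - r ^+ 2) * (2 * pi * cos d).
  have -> : (1 - r ^+ 2) * (2 * pi * cos d) =
      \int[mu]_(s in period) ((1 - r ^+ 2) * cos d).
    by rewrite Rintegral_cst//= measure_period/=; ring.
  transitivity (\int[mu]_(s in period) ((1 + r ^+ 2) * F 0 d s +
    (- r * F 1 d s + - r * F 1 (- d) s))).
    rewrite !RintegralD_period; [|exact: FZ|exact: FZ|exact: FZ|]; last first.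
      by move=> s; apply: cvgD; exact: FZ.
    by rewrite !RintegralZ_period//; rewrite /J; ring.
  apply: eq_Rintegral => s _; rewrite -(poisson_cos_rec (s - t) d r0 r1) /F.
  rewrite mul0r add0r mul1r (addrC _ d); congr (_ + (_ + _ * (_ * _))).
  by rewrite -cosN opprD opprK addrC.
have := E c; have := E (- c); rewrite opprK cosN !(J_geo 1) expr1.
set p := pi; set u := J 0 c; set v := J 0 (- c); set k := cos c => E1 E2.
have r2 : 1 - r ^+ 2 != 0.
  by rewrite subr_eq0 eq_sym lt_eqF// expr_lt1.
have uv : u = v.
  have : (1 + r ^+ 2) * (u - v) = 0 by lra.
  move/eqP; rewrite mulf_eq0 subr_eq0 => /orP[|/eqP//].
  by rewrite gt_eqF// ltr_pwDl// sqr_ge0.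
apply: (mulfI r2); rewrite -E1 -uv; ring.
Qed.

Lemma Rintegral_poisson_cos n c :
  \int[mu]_(s in period) (poisson r (s - t) * cos (n%:R * s + c)) =
  2 * pi * (r ^+ n * cos (n%:R * t + c)).
Proof.
rewrite [RHS]mulrCA -J0 -J_geo; apply: eq_Rintegral => s _; rewrite /F.
by congr (_ * cos _); ring.
Qed.

Lemma Rintegral_poisson : \int[mu]_(s in period) poisson r (s - t) = 2 * pi.
Proof.
have := Rintegral_poisson_cos 0 0; rewrite mul1r mul0r addr0 cos0 mulr1 => H.
rewrite -[RHS]H.
by apply: eq_Rintegral => s _; rewrite mul0r addr0 cos0 mulr1.
Qed.

Lemma Rintegral_poisson_tpoly al be N M :
  \int[mu]_(s in period) (poisson r (s - t) * tpoly al be N M s) =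
  2 * pi * \sum_(N <= n < M) r ^+ n * wave al be n t.
Proof.
have cp := continuous_poisson (t := t) r0 r1.
have c1 n c : continuous (fun s => poisson r (s - t) * cos (n%:R * s + c)).
  by move=> s; apply: cvgM; [exact: cp|exact: continuous_cos_affine].
have c2 k n c : continuous (fun s => k * (poisson r (s - t) * cos (n%:R * s + c))).
  by move=> s; apply: cvgM; [exact: cvg_cst|exact: c1].
have H n s : poisson r (s - t) * wave al be n s =
    al n * (poisson r (s - t) * cos (n%:R * s + 0)) +
    be n * (poisson r (s - t) * cos (n%:R * s + - (pi / 2))).
  by rewrite waveE; ring.
under eq_Rintegral do rewrite /tpoly mulr_sumr.
rewrite Rintegral_sum_period => [|n]; last first.
  by rewrite (funext (H n)) => s; apply: cvgD; exact: c2.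
rewrite mulr_sumr; apply: eq_bigr => n _.
under eq_Rintegral do rewrite H.
rewrite RintegralD_period ?RintegralZ_period//.
by rewrite !Rintegral_poisson_cos waveE; ring.
Qed.

End moments.
End poisson_kernel.

(** * L1 limits of Fourier series *)

(** Riesz-Fischer argument: the sum [G] of the absolute increments is integrable, hence finite
    almost everywhere, so [f k x] converges there, and [|f 0| + G] dominates every [f k]. *)
Lemma fast_cauchy_L1_cvg d (T : measurableType d) (R : realType)
    (mu : {measure set T -> \bar R}) (D : set T) (f : nat -> T -> R) (C : R) :
  measurable D -> (forall k, mu.-integrable D (EFin \o f k)) ->
  (forall k, (\int[mu]_(x in D) `|f k.+1 x - f k x|%:E <= (C / 2 ^+ k)%:E)%E) ->
  exists phi : T -> R, mu.-integrable D (EFin \o phi) /\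
    (\int[mu]_(x in D) `|f k x - phi x|)%R @[k --> \oo] --> (0 : R).
Proof.
move=> mD fi fC.
pose d_ k x : \bar R := `|f k.+1 x - f k x|%:E.
have mf k : measurable_fun D (f k) by apply/measurable_EFinP; case/integrableP: (fi k).
have md k : measurable_fun D (d_ k).
  by apply/measurable_EFinP; apply: measurableT_comp => //; exact: measurable_funB.
have d0 k x : (0 <= d_ k x)%E by rewrite lee_fin.
pose G x := (\sum_(k <oo) d_ k x)%E.
have G0 x : (0 <= G x)%E by apply: nneseries_ge0.
have iG : mu.-integrable D G.
  apply/integrableP; split; first exact: ge0_emeasurable_sum.
  under eq_integral do rewrite gee0_abs//.
  rewrite /G integral_nneseries//.
  apply: (@le_lt_trans _ _ (\sum_(k <oo) ((2 * C) / (2 ^ (k + 1))%:R)%:E)%E).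
    apply: lee_nneseries => [k _ _|k _]; first exact: integral_ge0.
    apply: (le_trans (fC k)); rewrite lee_fin addn1 natrX exprS invfM.
    by rewrite -mulrA [X in _ <= X]mulrCA !mulrA mulfK//.
  by rewrite (cvg_lim _ (@cvg_geometric_eseries_half _ (2 * C) 0))// ltry.
(* The upper limit is measurable whether or not the sequence converges, and equals the limit
   wherever it does. *)
pose phi x := fine (limn_esup (fun k => (f k x)%:E)).
have mphi : measurable_fun D (EFin \o phi).
  apply/measurable_EFinP.
  apply: (@measurableT_comp _ _ _ _ _ _ fine); first exact: fine_measurable.
  apply: measurable_fun_limn_esup => k; exact/measurable_EFinP.
have dom x k : (`|f k x|%:E <= `|f 0%N x|%:E + G x)%E.
  apply: (@le_trans _ _ (`|f 0%N x|%:E + \sum_(0 <= j < k) d_ j x)%E); last first.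
    by apply: leeD2l; apply: nneseries_lim_ge.
  rewrite sumEFin -EFinD lee_fin.
  have -> : f k x = f 0%N x + \sum_(0 <= j < k) (f j.+1 x - f j x).
    by rewrite telescope_sumr// addrC subrK.
  by apply: (le_trans (ler_normD _ _)); rewrite lerD2l ler_norm_sum.
have [|||||h1 h2 _] := @dominated_convergence _ T R mu D mD (fun k => EFin \o f k) (EFin \o phi)
  (fun x => `|f 0%N x|%:E + G x)%E.
- by move=> k; exact/measurable_EFinP.
- exact: mphi.
- apply: filterS (integrable_ae mD iG) => x h Dx.
  have Gfin := h Dx.
  have cd : cvgn (series (fun k => f k.+1 x - f k x)).
    apply: normed_cvg; apply: nnseries_is_cvg => [i|].
      exact: normr_ge0.
    have : (G x < +oo)%E by rewrite -ge0_fin_numE.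
    by [].
  have cf : cvgn (f ^~ x).
    have -> : f ^~ x = (fun k => f 0%N x + series (fun k => f k.+1 x - f k x) k).
      by apply/funext => k; rewrite /series/= telescope_sumr// addrC subrK.
    by apply: is_cvgD => //; exact: is_cvg_cst.
  have cfE : (fun k => (f k x)%:E) @ \oo --> (limn (f ^~ x))%:E.
    by apply: cvg_EFin => //; exact: nearW.
  by rewrite /phi/= (cvg_limn_einf_sup cfE).2.
- by apply: integrableD => //; apply: integrable_norm; exact: fi.
- by apply: aeW => x k _; exact: dom.
- exists phi; split => //.
  apply: (@fine_cvg _ _ _ _ (fun k => \int[mu]_(x in D) `|f k x - phi x|%:E)%E).
  exact: h2.
Qed.

(** The [q n] will be squared moduli of coefficients, so a tail of at most [4 ^- k] has L^2 size of
    order [2 ^- k]. The bound [k <= N k] makes [N] cofinal. *)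
Definition fast_tails (R : realType) (q : nat -> R) (N : nat -> nat) : Prop :=
  [/\ forall k, (k <= N k)%N, forall k, (N k <= N k.+1)%N &
      forall k M, \sum_(N k <= n < M) q n <= (4 ^+ k)^-1].

Lemma exists_fast_tails (R : realType) (q : nat -> R) :
  cvgn (series q) -> exists N, fast_tails q N.
Proof.
move=> cq.
have tail k : exists n0, forall N M, (n0 <= N)%N ->
    \sum_(N <= n < M) q n <= (4 ^+ k)^-1.
  have e0 : 0 < (4 ^+ k)^-1 :> R by rewrite invr_gt0 exprn_gt0.
  have /cauchy_cvgP/cauchy_seriesP/(_ _ e0) := cq.
  move=> [[A B] [[a _ aA] [b _ bB]] AB].
  exists (maxn a b) => N M; rewrite geq_max => /andP[aN bN].
  have [NM|MN] := leqP N M; last by rewrite big_geq ?(ltW e0)// ltnW.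
  apply/ltW/(le_lt_trans (ler_norm _)).
  apply: (AB (N, M)); split => /=; first exact: aA.
  by apply: bB => /=; exact: leq_trans NM.
have [nu nuP] := choice tail.
(* Summing all thresholds up to [k], each increased by 1, meets the three requirements at once: [N]
   is monotone, at least [k] and at least [nu k]. *)
pose N k := (\sum_(0 <= j < k.+1) (nu j).+1)%N.
exists N; split=> [k|k|k M].
- elim: k => // k IH; rewrite /N big_nat_recr//= -/(N k).
  by rewrite addnS ltnS (leq_trans IH)// leq_addr.
- by rewrite /N (big_nat_recr k.+1)//= leq_addr.
- by apply: nuP; rewrite /N big_nat_recr//= (leq_trans (leqnSn _))// leq_addl.
Qed.

Section fourier_series.
Context {R : realType}.
Local Notation mu := (@lebesgue_measure R).
Local Notation period := (`[0 : R, 2 * pi]%classic).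
Variables (al be : nat -> R) (N : nat -> nat).
Hypothesis fastN : fast_tails (fun n => al n ^+ 2 + be n ^+ 2) N.

Lemma riesz_fischer_L1 : exists phi : R -> R, mu.-integrable period (EFin \o phi) /\
  (\int[mu]_(t in period) `|tpoly al be 0 (N k) t - phi t|)%R @[k --> \oo] --> (0 : R).
Proof.
have [kN NS tailN] := fastN.
have [//||k|phi [iphi cphi]] := @fast_cauchy_L1_cvg _ _ R mu period
  (fun k => tpoly al be 0 (N k)) (2 * pi).
- by move=> k; apply: continuous_integrable_period; exact: continuous_tpoly.
- have ct := @continuous_tpoly _ al be (N k) (N k.+1).
  pose D t := tpoly al be (N k) (N k.+1) t.
  have -> : (\int[mu]_(t in period)
      `|tpoly al be 0 (N k.+1) t - tpoly al be 0 (N k) t|%:E)%E =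
    (\int[mu]_(t in period) `|D t|%:E)%E.
    apply: eq_integral => t _; congr (`|_|%:E).
    by rewrite /tpoly (@big_cat_nat _ _ _ (N k) 0 (N k.+1))//= addrAC subrr add0r.
  have iD : mu.-integrable period (EFin \o (fun t => `|D t|)).
    by apply: continuous_integrable_period => t; apply: cvg_norm; exact: ct.
  have iD2 : continuous (fun t => 2^-1 * ((2 ^+ k)^-1 + 2 ^+ k * D t ^+ 2)).
    move=> t; apply: cvgM; first exact: cvg_cst.
    apply: cvgD; first exact: cvg_cst.
    apply: cvgM; first exact: cvg_cst.
    by apply: cvgM; exact: ct.
  rewrite -[leLHS]fineK ?integrable_fin_num// lee_fin.
  rewrite -/(Rintegral mu period (fun t => `|D t|)).
  (* Cauchy-Schwarz in the form [2 * |D| <= 2 ^- k + 2 ^+ k * D ^+ 2]. The weight balances the two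
     integrals, each contributing at most [pi / 2 ^+ k], whence the constant [2 * pi]. *)
  apply: (@le_trans _ _
    (\int[mu]_(t in period) (2^-1 * ((2 ^+ k)^-1 + 2 ^+ k * D t ^+ 2)))).
    apply: le_Rintegral => //; first exact: continuous_integrable_period.
    move=> t _; have p0 : 0 < 2 ^+ k :> R by rewrite exprn_gt0.
    rewrite -(@ler_pM2l _ (2 * 2 ^+ k)) ?mulr_gt0//.
    have -> : 2 * 2 ^+ k * (2^-1 * ((2 ^+ k)^-1 + 2 ^+ k * D t ^+ 2)) =
        1 + (2 ^+ k * `|D t|) ^+ 2.
      by rewrite exprMn real_normK ?num_real//; field; rewrite lt0r_neq0.
    by have := sqr_ge0 (2 ^+ k * `|D t| - 1); lra.
  have c2 : continuous (fun t => D t ^+ 2) by move=> t; apply: cvgM; exact: ct.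
  have c3 : continuous (fun t => 2 ^+ k * D t ^+ 2).
    by move=> t; apply: cvgM; [exact: cvg_cst|exact: c2].
  rewrite RintegralZ_period; last by move=> t; apply: cvgD; [exact: cvg_cst|exact: c3].
  rewrite RintegralD_period//; last by move=> t; exact: cvg_cst.
  rewrite RintegralZ_period// Rintegral_cst//= measure_period/=.
  have h1 := Rintegral_tpoly_sqr al be (N k) (N k.+1).
  have h2 := tailN k (N k.+1).
  have p0 : 0 < pi :> R := pi_gt0 R.
  have h3 : \int[mu]_(t in period) D t ^+ 2 <= 2 * pi * (4 ^+ k)^-1.
    by apply: (le_trans h1); rewrite ler_pM2l ?mulr_gt0.
  have -> : 2 * pi / 2 ^+ k = 2^-1 * ((2 ^+ k)^-1 * (2 * pi) +
      2 ^+ k * (2 * pi * (4 ^+ k)^-1)) :> R.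
    rewrite (_ : 4 = 2 * 2 :> R) ?exprMn; last by rewrite -natrM.
    by field; rewrite lt0r_neq0// exprn_gt0.
  by rewrite ler_pM2l// lerD2l ler_pM2l// exprn_gt0.
- by exists phi.
Qed.

End fourier_series.

(** * Fatou's theorem *)

Section poisson_bounds.
Context {R : realType}.
Implicit Types r x eta h : R.

(** By the mean value theorem [sin x / x] is a value of [cos] inside the unit interval, where [cos]
    exceeds [cos 1]. This serves below as an explicit positive constant. *)
Lemma sin_ge_linear x : 0 <= x <= 1 -> cos 1 * x <= sin x.
Proof.
move=> /andP[x0 x1].
have [->|xn0] := eqVneq x 0; first by rewrite mulr0 sin0.
have {x0 xn0}x0 : 0 < x by rewrite lt_def xn0 x0.
have [c|c /[!in_itv]/= /andP[c0 cx]] := @MVT R sin cos 0 x x0 (fun y _ => is_derive_sin y).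
  exact/continuous_subspaceT/continuous_sin.
rewrite sin0 !subr0 => ->; rewrite ler_pM2r//.
have p2 : 2 <= pi :> R := pi_ge2 R.
have := @ltr_cos R; move=> /(_ c 1); rewrite !in_itv/= => h.
by apply/ltW; rewrite h//; lra.
Qed.

Lemma one_minus_cos_ge x : `|x| <= 1 -> cos 1 ^+ 2 * x ^+ 2 / 2 <= 1 - cos x.
Proof.
move=> x1; rewrite -(cos_norm x) -(@real_normK _ x) ?num_real//.
have : 0 <= `|x| by [].
move: `|x| x1 => y x1 x0 {x}; move: y x1 x0 => x x1 x0.
have : 0 <= x / 2 <= 1 by lra.
move=> /sin_ge_linear h.
have -> : cos x = 1 - 2 * sin (x / 2) ^+ 2.
  have -> : cos x = cos ((x / 2) *+ 2) by congr cos; rewrite mulr2n; field.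
  by rewrite cos_mulr2n cos2sin2; rewrite !mulr2n; ring.
have c1 : 0 < cos 1 :> R := cos1_gt0 R.
have : (cos 1 * (x / 2)) ^+ 2 <= sin (x / 2) ^+ 2.
  by rewrite lerXn2r// nnegrE; [|apply: le_trans h]; rewrite ?mulr_ge0// ?divr_ge0// ltW.
by set c := cos 1; set s := sin _; nra.
Qed.

(** The denominator is [(1 - r) ^+ 2 + 2 * r * (1 - cos x)]; with [2 * r >= 1] and the lower bound
    on [1 - cos x] it is at least [cos 1 ^+ 2 / 2] times [(1 - r) ^+ 2 + x ^+ 2]. The other factor 2
    of the constant bounds [1 + r]. *)
Lemma poisson_le_near r x : 2^-1 <= r -> r < 1 -> `|x| <= 1 ->
  poisson r x <= 4 / cos 1 ^+ 2 * ((1 - r) / ((1 - r) ^+ 2 + x ^+ 2)).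
Proof.
move=> r2 r1 /one_minus_cos_ge h.
have r0 : 0 <= r by lra.
have c1 : 0 < cos 1 :> R := cos1_gt0 R.
have c2 : cos 1 <= 1 :> R := cos_le1 1.
have den : 0 < 1 - 2 * r * cos x + r ^+ 2 by exact: poisson_den_gt0.
have x2 : 0 <= x ^+ 2 := sqr_ge0 x.
have n1 : 0 < (1 - r) ^+ 2 by rewrite exprn_gt0// subr_gt0.
have den2 : 0 < (1 - r) ^+ 2 + x ^+ 2 by lra.
rewrite /poisson mulf_div ler_pdivrMr// mulrAC ler_pdivlMr; last first.
  by rewrite mulr_gt0// exprn_gt0.
set c := cos 1 in c1 c2 h *; set k := cos x in h den *.
have c21 : c ^+ 2 <= 1 by rewrite expr_le1// ltW.
have key : c ^+ 2 * ((1 - r) ^+ 2 + x ^+ 2) <= 2 * (1 - 2 * r * k + r ^+ 2).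
  have : 0 <= (1 - k - c ^+ 2 * x ^+ 2 / 2) * (2 * r - 1) by rewrite mulr_ge0; lra.
  have : 0 <= (1 - c ^+ 2) * (1 - r) ^+ 2 by rewrite mulr_ge0 ?subr_ge0 ?(ltW n1).
  have : 0 <= c ^+ 2 * x ^+ 2 by rewrite mulr_ge0// sqr_ge0.
  nra.
have h1 : 0 <= 1 - r by lra.
have -> : 1 - r ^+ 2 = (1 - r) * (1 + r) by ring.
have -> : 4 * (1 - r) * (1 - 2 * r * k + r ^+ 2) =
  (1 - r) * (2 * (2 * (1 - 2 * r * k + r ^+ 2))) by ring.
rewrite -(mulrA (1 - r)) ler_wpM2l//.
apply: (@le_trans _ _ (2 * (c ^+ 2 * ((1 - r) ^+ 2 + x ^+ 2)))); last by lra.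
by apply: ler_wpM2r; [rewrite mulr_ge0// ?sqr_ge0// ltW|lra].
Qed.

(** Cosine decreases on [[0, pi]], and values above [pi] are reflected to [2 * pi - x]. The range
    extends to [2 * pi - h] because two points of the period may be almost [2 * pi] apart. *)
Lemma cos_le_far h x : 0 < h <= pi -> h <= `|x| <= 2 * pi - h -> cos x <= cos h.
Proof.
move=> /andP[h0 hpi] /andP[hx xh]; rewrite -cos_norm.
move: `|x| hx xh => y hx xh {x}; move: y hx xh => x hx xh.
have mono y : h <= y <= pi -> cos y <= cos h.
  move=> /andP[hy ypi]; have [->//|yh] := eqVneq y h.
  have := @ltr_cos R h y; rewrite !in_itv/= => H.
  by apply/ltW; rewrite H ?lt_def ?yh//; lra.
have [xpi|pix] := leP x pi; first by apply: mono; rewrite hx.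
rewrite -(cosN x) -cosD2pi; apply: mono.
by rewrite -mulr_natl; lra.
Qed.

(** Since [2 * r >= 1], the denominator is at least [1 - cos x], and [1 - r ^+ 2 <= 2 * (1 - r)].
    The point is the factor [1 - r], which tends to 0 for fixed [h]. *)
Lemma poisson_le_far r h x : 2^-1 <= r -> r < 1 -> 0 < h <= pi ->
  h <= `|x| <= 2 * pi - h -> poisson r x <= 2 * (1 - r) / (1 - cos h).
Proof.
move=> r2 r1 hpi hx; have ch := cos_le_far hpi hx.
have r0 : 0 <= r by lra.
have c1 : cos h < 1.
  move: hpi => /andP[h0 hp].
  rewrite -cos0 (@ltr_cos R)// in_itv/= ?lexx ?pi_ge0//.
  by rewrite ltW.
have den : 0 < 1 - 2 * r * cos x + r ^+ 2 by exact: poisson_den_gt0.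
have c1' : 0 < 1 - cos h by lra.
rewrite /poisson ler_pdivrMr// mulrAC ler_pdivlMr//.
move: (cos h) (cos x) c1 c1' ch den => c k c1 c1' ck den.
have -> : 1 - r ^+ 2 = (1 - r) * (1 + r) by ring.
have -> : 2 * (1 - r) * (1 - 2 * r * k + r ^+ 2) =
  (1 - r) * (2 * (1 - 2 * r * k + r ^+ 2)) by ring.
rewrite -(mulrA (1 - r)) ler_wpM2l//; first by lra.
have h1 : 0 <= (c - k) * r by rewrite mulr_ge0//; lra.
have h2 : 0 <= (1 - r) ^+ 2 := sqr_ge0 _.
have h3 : 0 <= (1 - c) * (2 * r - 1) by rewrite mulr_ge0//; lra.
have h4 : 0 <= (1 - c) * (1 - r) by rewrite mulr_ge0//; lra.
nra.
Qed.

(* The least [j] with [`|x| < 2 ^ j * eta] already gives a large enough term. *)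
Lemma cauchy_kernel_dyadic eta x J : 0 < eta -> `|x| < 2 ^+ J * eta ->
  eta / (eta ^+ 2 + x ^+ 2) <=
  \sum_(0 <= j < J.+1) 4 / (4 ^+ j * eta) * (`|x| < 2 ^+ j * eta)%R%:R.
Proof.
move=> e0; have x2 : 0 <= x ^+ 2 := sqr_ge0 x.
have e2 : 0 < eta ^+ 2 by rewrite exprn_gt0.
elim: J => [xe|J IH xe].
  rewrite expr0 mul1r in xe; rewrite big_nat1 !expr0 !mul1r xe mulr1.
  rewrite ler_pdivrMr ?ltr_pwDl// mulrAC ler_pdivlMr//.
  by rewrite -expr2; lra.
rewrite big_nat_recr//=.
have [/IH h|xJ] := ltP `|x| (2 ^+ J * eta).
  by apply: (le_trans h); rewrite lerDl mulr_ge0// divr_ge0// mulr_ge0 ?exprn_ge0// ltW.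
rewrite xe mulr1; apply: ler_wpDl.
  by apply: sumr_ge0 => j _; rewrite mulr_ge0// divr_ge0// mulr_ge0 ?exprn_ge0// ltW.
have p4 : 0 < 4 ^+ J :> R by rewrite exprn_gt0.
(* In the outermost annulus the kernel is at most [1 / (4 ^+ J * eta)], which is the term of index
   [J.+1]; this is where the numerator 4 comes from. *)
have H : 4 ^+ J * eta ^+ 2 <= x ^+ 2.
  rewrite -[x ^+ 2]real_normK ?num_real//.
  rewrite (_ : 4 ^+ J * eta ^+ 2 = (2 ^+ J * eta) ^+ 2).
    by apply: lerXn2r; rewrite ?nnegrE ?mulr_ge0 ?exprn_ge0// ltW.
  rewrite (_ : 4 = 2 * 2 :> R) ?exprMn; last by rewrite -natrM.
  by ring.
rewrite ler_pdivrMr ?ltr_pwDl// mulrAC ler_pdivlMr; last first.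
  by rewrite mulr_gt0// exprn_gt0.
by rewrite exprS; nra.
Qed.

End poisson_bounds.

Lemma cvg_dist_le (K : numFieldType) (V : normedModType K) (T : Type)
    (F : set_system T) (FF : Filter F) (f : T -> V) (l : V) (e : T -> K) :
  (\forall x \near F, `|f x - l| <= e x) -> e @ F --> (0 : K) -> f @ F --> l.
Proof.
move=> fe /cvgrPdist_lt e0; apply/cvgrPdist_lt => eps eps0.
have := e0 _ eps0; apply: filterS2 fe => x fx; rewrite sub0r normrN distrC => ex.
rewrite (le_lt_trans fx)// (le_lt_trans _ ex)// ger0_norm//.
exact: le_trans (normr_ge0 _) fx.
Qed.

(** * L^1 convergence against bounded multipliers *)

Section bounded_multiplier.
Context d (T : measurableType d) (R : realType) (mu : {measure set T -> \bar R}).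
Variables (D : set T) (mD : measurable D).
Implicit Types (f g phi : T -> R) (B : R).

Lemma integrable_bounded_mul g B f : measurable_fun D g ->
  (forall x, D x -> `|g x| <= B) -> mu.-integrable D (EFin \o f) ->
  mu.-integrable D (EFin \o (fun x => g x * f x)).
Proof.
move=> mg gB fi; have -> : EFin \o (fun x => g x * f x) = ((EFin \o g) \* (EFin \o f))%E.
  by apply/funext => x /=; rewrite EFinM.
apply: integrableMr => //; exists B; split => [|y By x Dx]; first exact: num_real.
exact: le_trans (gB x Dx) (ltW By).
Qed.

Lemma cvg_Rintegral_bounded_mul g B (f : nat -> T -> R) phi :
  measurable_fun D g -> (forall x, D x -> `|g x| <= B) ->
  (forall k, mu.-integrable D (EFin \o f k)) -> mu.-integrable D (EFin \o phi) ->
  (\int[mu]_(x in D) `|f k x - phi x|)%R @[k --> \oo] --> (0 : R) ->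
  (\int[mu]_(x in D) (g x * f k x))%R @[k --> \oo] -->
    (\int[mu]_(x in D) (g x * phi x))%R.
Proof.
move=> mg gB fi phii cf.
have di k : mu.-integrable D (EFin \o (fun x => f k x - phi x)).
  by have := integrableB mD (fi k) phii.
have cB : (`|B| * \int[mu]_(x in D) `|f k x - phi x|)%R @[k --> \oo] --> (0 : R).
  by rewrite -[X in _ --> X](mulr0 `|B|); apply: cvgM => //; exact: cvg_cst.
apply: cvg_dist_le cB; apply: nearW => k.
have gfi := integrable_bounded_mul mg gB (fi k).
have gphii := integrable_bounded_mul mg gB phii.
have idf : mu.-integrable D (EFin \o (fun x => g x * f k x - g x * phi x)).
  by have := integrableB mD gfi gphii.
rewrite -RintegralB//; apply: (le_trans (le_normr_Rintegral mD idf)).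
rewrite -RintegralZl//; last exact: (integrable_norm (di k)).
apply: le_Rintegral => //.
- exact: (integrable_norm idf).
- by have := integrableZl mD `|B| (integrable_norm (di k)).
- move=> x Dx; rewrite -mulrBr normrM ler_wpM2r//.
  exact: le_trans (gB x Dx) (ler_norm _).
Qed.

End bounded_multiplier.

(** * Poisson integrals of L^1 limits of trigonometric polynomials *)

Section poisson_integral.
Context {R : realType}.
Local Notation mu := (@lebesgue_measure R).
Local Notation period := (`[0 : R, 2 * pi]%classic).

Lemma cvg_subseq (V : topologicalType) (u : nat -> V) (N : nat -> nat) (l : V) :
  (forall k, (k <= N k)%N) -> u @ \oo --> l -> u (N k) @[k --> \oo] --> l.
Proof.
move=> kN ul; have NN : N @ \oo --> \oo.
  by move=> P [n _ nP]; exists n => // k /= nk; apply: nP => /=; exact: leq_trans (kN k).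
exact: cvg_comp NN ul.
Qed.

Lemma poisson_norm_le r x : 0 <= r -> r < 1 -> `|poisson r x| <= (1 - r) ^- 2 :> R.
Proof.
move=> r0 r1; rewrite ger0_norm ?poisson_ge0// /poisson.
have p0 : 0 < (1 - r) ^+ 2 by rewrite exprn_gt0// subr_gt0.
rewrite -[leRHS]mul1r ler_pM//.
- by rewrite subr_ge0 expr_le1// ltW.
- by rewrite invr_ge0 ltW// poisson_den_gt0.
- by rewrite gerBl// sqr_ge0.
- by rewrite lef_pV2 ?posrE ?poisson_den_gt0// poisson_den_ge.
Qed.

(** For the partial sums this is [Rintegral_poisson_tpoly]. At fixed [r] the kernel is bounded, so
    L^1 convergence gives the limit of the integrals, while the series gives the limit of the
    values. *)
Lemma poisson_representation al be (N : nat -> nat) phi r t (v : R) :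
  (forall k, (k <= N k)%N) -> mu.-integrable period (EFin \o phi) ->
  (\int[mu]_(s in period) `|tpoly al be 0 (N k) s - phi s|)%R
    @[k --> \oo] --> (0 : R) ->
  0 <= r -> r < 1 -> series (fun n => r ^+ n * wave al be n t) @ \oo --> v ->
  (\int[mu]_(s in period) (poisson r (s - t) * phi s))%R = 2 * pi * v.
Proof.
move=> kN iphi cphi r0 r1 cv.
have mp : measurable_fun period (fun s => poisson r (s - t)).
  by apply: measurable_funTS; apply: continuous_measurable_fun; exact: continuous_poisson.
have it k : mu.-integrable period (EFin \o tpoly al be 0 (N k)).
  by apply: continuous_integrable_period; exact: continuous_tpoly.
have : (\int[mu]_(s in period) (poisson r (s - t) * tpoly al be 0 (N k) s))%R
    @[k --> \oo] --> (\int[mu]_(s in period) (poisson r (s - t) * phi s))%R.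
  apply: (@cvg_Rintegral_bounded_mul _ _ R mu period _ _ ((1 - r) ^- 2)) => //.
  by move=> s _; exact: poisson_norm_le.
under eq_fun do rewrite Rintegral_poisson_tpoly//.
move=> h; apply: (cvg_unique _ h) => //.
by apply: cvgM; [exact: cvg_cst|exact: (cvg_subseq kN cv)].
Qed.

End poisson_integral.

(** * Poisson averages around a Lebesgue point *)

Section lebesgue_points.
Context {R : realType}.
Local Notation mu := (@lebesgue_measure R).
Local Notation period := (`[0 : R, 2 * pi]%classic).

(** The least [J] with [h <= 2 ^+ J * eta] overshoots by less than a factor 2; for [J = 0] this is
    [eta <= h]. The dyadic balls then cover radius [h] and stay inside radius [2 * h]. *)
Lemma exists_dyadic_scale (eta h : R) : 0 < eta <= h ->
  exists J, h <= 2 ^+ J * eta < 2 * h.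
Proof.
move=> /andP[e0 eh].
have ex : exists J, h <= 2 ^+ J * eta.
  exists (Num.bound (h / eta)); rewrite -ler_pdivrMr//.
  have h0 : 0 <= h / eta by rewrite divr_ge0 ?(ltW e0)// (le_trans _ eh)// ltW.
  apply/ltW/(lt_trans (archi_boundP h0)).
  by rewrite -natrX ltr_nat ltn_expl.
have [J hJ Jmin] := ex_minnP ex; exists J; rewrite hJ/=.
case: J => [|J] in hJ Jmin *; first by rewrite expr0; lra.
rewrite exprS -mulrA ltr_pM2l//; rewrite ltNge; apply/negP => /Jmin.
by rewrite ltnn.
Qed.

Lemma lebesgue_pt_near (phi : R -> R) t (e : R) : 0 < e -> lebesgue_pt phi t ->
  exists2 h : R, 0 < h & forall rho, 0 < rho < h ->
    (\int[mu]_(s in ball t rho) `|phi s - phi t|%:E <= (2 * rho * e)%:E)%E.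
Proof.
move=> e0 /fine_cvgP[fin /cvgrPdist_lt/(_ _ e0) lim].
have [h /= h0 H] := filterI fin lim.
exists h => // rho /andP[rho0 rhoh].
have [|//|fr lr] := H rho; first by rewrite /= sub0r normrN gtr0_norm.
move: fr lr; rewrite /davg /iavg/= (lebesgue_measure_ball _ (ltW rho0)).
rewrite -[X in fine X]/(_ * _)%E.
set I := (\int[mu]_(s in _) _)%E.
have I0 : (0 <= I)%E by exact: integral_ge0.
have -> : ((rho *+ 2)%:E^-1)%E = ((2 * rho)^-1)%:E.
  by rewrite inver mulr_natl mulrn_eq0/= gt_eqF.
case: I I0 => [x|_|//].
  rewrite lee_fin => x0 _; rewrite -EFinM/= sub0r normrN => xe.
  rewrite lee_fin -ler_pdivrMl ?mulr_gt0//.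
  by apply/ltW/(le_lt_trans _ xe); rewrite ler_norm.
(* An infinite integral would make the average infinite, contrary to its finiteness for small
   radii. *)
by rewrite mulry gtr0_sg ?invr_gt0 ?mulr_gt0// mul1e.
Qed.

Lemma sum_dyadic_le (c : R) n : 0 <= c -> \sum_(0 <= j < n) c / 2 ^+ j <= 2 * c.
Proof.
move=> c0; suff -> : \sum_(0 <= j < n) c / 2 ^+ j = 2 * c - 2 * c / 2 ^+ n.
  by rewrite gerBl// divr_ge0 ?mulr_ge0// exprn_ge0.
elim: n => [|n IH]; first by rewrite big_nil expr0 divr1 subrr.
by rewrite big_nat_recr//= IH exprS; field; rewrite expf_neq0.
Qed.

(** Within distance [h] of [t] the kernel is dominated by multiples [c j] of indicators of balls of
    radius [2 ^+ j * eta], where [eta = 1 - r]. Ball [j] contributes at most [8 * C * e / 2 ^+ j]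
    with [C = 4 / cos 1 ^+ 2], and the total [16 * C * e] is the first term. Farther away the kernel
    is uniformly small; the condition on [t] keeps [|s - t|] at most [2 * pi - h]. *)
Lemma poisson_integral_le (g : R -> R) (t h e r : R) :
  measurable_fun setT g -> (forall s, 0 <= g s) ->
  mu.-integrable period (EFin \o g) ->
  (forall rho, 0 < rho < 2 * h ->
    (\int[mu]_(s in ball t rho) (g s)%:E <= (2 * rho * e)%:E)%E) ->
  0 <= e -> 0 < h <= 1 -> h <= t <= 2 * pi - h -> 2^-1 <= r < 1 -> 1 - r <= h ->
  \int[mu]_(s in period) (poisson r (s - t) * g s) <=
  64 / cos 1 ^+ 2 * e + 2 * (1 - r) / (1 - cos h) * \int[mu]_(s in period) g s.
Proof.
move=> mg g0 ig gball e0 /andP[h0 h1] /andP[ht th] /andP[r2 r1] rh.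
have r0 : 0 <= r by lra.
pose eta := 1 - r.
have eta0 : 0 < eta by rewrite /eta; lra.
have [|J /andP[hJ Jh]] := @exists_dyadic_scale eta h; first by rewrite eta0.
have k0 : 0 < cos 1 :> R := cos1_gt0 R.
pose C : R := 4 / cos 1 ^+ 2.
have C0 : 0 < C by rewrite divr_gt0// exprn_gt0.
pose c j := C * (4 / (4 ^+ j * eta)).
have c0 j : 0 <= c j by rewrite mulr_ge0 ?(ltW C0)// divr_ge0// mulr_ge0 ?exprn_ge0// ltW.
pose D := 2 * (1 - r) / (1 - cos h).
have p2 : 2 <= pi :> R := pi_ge2 R.
have D0 : 0 <= D.
  by rewrite divr_ge0 ?subr_ge0 ?cos_le1// mulr_ge0// ltW.
pose B j := ball t (2 ^+ j * eta).
have ptw s : period s -> poisson r (s - t) * g s <=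
    \sum_(0 <= j < J.+1) c j * (g \_ (B j)) s + D * g s.
  rewrite /= in_itv/= => /andP[s0 s2].
  have S0 : 0 <= \sum_(0 <= j < J.+1) c j * (g \_ (B j)) s.
    by apply: sumr_ge0 => j _; rewrite mulr_ge0// patchE; case: ifP.
  have [sh|sh] := ltP `|s - t| h.
    apply: ler_wpDr; first by rewrite mulr_ge0.
    have := poisson_le_near r2 r1 (le_trans (ltW sh) h1).
    have := cauchy_kernel_dyadic eta0 (lt_le_trans sh hJ).
    move=> /(ler_wpM2l (ltW C0)) k1 k2.
    have {k1 k2}/(ler_wpM2r (g0 s)) := le_trans k2 k1.
    move/le_trans; apply.
    rewrite mulr_sumr mulr_suml; apply: ler_sum => j _.
    rewrite mulrA -/(c j) -mulrA ler_wpM2l//.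
    rewrite patchE; case: ifPn => [|/negP sB].
      by rewrite inE /B /ball/= distrC => ->; rewrite mul1r.
    rewrite ltNge; have [//|] := leP (2 ^+ j * eta) `|s - t|; first by rewrite mul0r.
    by move=> st; exfalso; apply: sB; rewrite inE /B /ball/= distrC.
  apply: ler_wpDl => //; rewrite ler_wpM2r//.
  apply: poisson_le_far => //; first by rewrite h0/=; lra.
  by rewrite sh/= ler_norml; lra.
have mB j : measurable (B j) by exact: measurable_ball.
have mgB j : measurable_fun setT (g \_ (B j)).
  by apply/(measurable_restrictT _ _).1 => //; exact: measurable_funTS.
have gB0 j s : 0 <= (g \_ (B j)) s by rewrite patchE; case: ifP.
have IB j : (j < J.+1)%N ->
    (\int[mu]_(s in period) ((g \_ (B j)) s)%:E <= (2 * (2 ^+ j * eta) * e)%:E)%E.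
  move=> jJ.
  have {}gball := gball (2 ^+ j * eta).
  apply: le_trans (gball _); last first.
    rewrite mulr_gt0 ?exprn_gt0//=; apply: le_lt_trans Jh.
    by rewrite ler_pM2r// ler_eXn2l// ltr1n.
  rewrite [leRHS]integral_mkcond.
  rewrite [leRHS](_ : _ = (\int[mu]_s ((g \_ (B j)) s)%:E)%E); last first.
    by apply: eq_integral => s _; rewrite !patchE; case: ifP.
  apply: ge0_subset_integral => //; first by apply/measurable_EFinP; exact: mgB.
  by move=> s _; rewrite lee_fin.
have iP : mu.-integrable period (EFin \o (fun s => poisson r (s - t) * g s)).
  apply: (@integrable_bounded_mul _ _ _ _ _ _ _ ((1 - r) ^- 2)) => //.
    by apply: measurable_funTS; apply: continuous_measurable_fun; exact: continuous_poisson.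
  by move=> s _; exact: poisson_norm_le.
have mcg j : measurable_fun period (fun s => c j * (g \_ (B j)) s).
  by apply: measurable_funM => //; exact: measurable_funTS.
have mDg : measurable_fun period (fun s => D * g s).
  by apply: measurable_funM => //; exact: measurable_funTS.
(* From here on the integrals are extended-real: for nonnegative functions, additivity and
   monotonicity ask only for measurability of the pieces. *)
rewrite -/D -lee_fin /Rintegral EFinD (EFinM D) !fineK ?integrable_fin_num//.
apply: (@le_trans _ _ (\int[mu]_(s in period)
    (\sum_(0 <= j < J.+1) (c j * (g \_ (B j)) s)%:E + (D * g s)%:E))%E).
  apply: ge0_le_integral => //.
  - by move=> s _; rewrite lee_fin mulr_ge0// poisson_ge0.
  - by case/integrableP : iP.
  - apply: emeasurable_funD.
      by apply: emeasurable_sum => j; apply/measurable_EFinP; exact: mcg.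
    by apply/measurable_EFinP; exact: mDg.
  - by move=> s ps; rewrite sumEFin -EFinD lee_fin ptw.
rewrite ge0_integralD//; last 4 first.
- by move=> s _; apply: sume_ge0 => j _; rewrite lee_fin mulr_ge0.
- by apply: emeasurable_sum => j; apply/measurable_EFinP; exact: mcg.
- by move=> s _; rewrite lee_fin mulr_ge0.
- by apply/measurable_EFinP; exact: mDg.
apply: leeD; last first.
  under eq_integral do rewrite EFinM.
  rewrite ge0_integralZl//; first exact/measurable_EFinP/measurable_funTS.
  by move=> s _; rewrite lee_fin.
rewrite ge0_integral_sum//; last 2 first.
- by move=> j; apply/measurable_EFinP; exact: mcg.
- by move=> j s _; rewrite lee_fin mulr_ge0.
apply: (@le_trans _ _ (\sum_(0 <= j < J.+1) (8 * C * e / 2 ^+ j)%:E)%E); last first.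
  rewrite sumEFin lee_fin; apply: le_trans (sum_dyadic_le _ _) _.
    by rewrite mulr_ge0// mulr_ge0// ltW.
  by rewrite /C le_eqVlt; apply/orP; left; apply/eqP; field; rewrite gt_eqF.
rewrite !big_mkord; apply: lee_sum => j _.
under eq_integral do rewrite EFinM.
rewrite ge0_integralZl//; last 3 first.
- by apply/measurable_EFinP/measurable_funTS; exact: mgB.
- by move=> s _; rewrite lee_fin.
- by rewrite lee_fin.
apply: (@le_trans _ _ ((c j)%:E * (2 * (2 ^+ j * eta) * e)%:E)%E).
  by rewrite lee_wpmul2l ?lee_fin// IB.
rewrite -EFinM lee_fin le_eqVlt; apply/orP; left; apply/eqP; rewrite /c.
rewrite (_ : 4 ^+ j = 2 ^+ j * 2 ^+ j); last by rewrite -exprMn -natrM.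
by field; rewrite expf_neq0//= gt_eqF.

Qed.

End lebesgue_points.

(** * Radial limits almost everywhere *)

Section fatou.
Context {R : realType}.
Local Notation mu := (@lebesgue_measure R).
Local Notation period := (`[0 : R, 2 * pi]%classic).

Lemma poisson_cvg_lebesgue_pt (phi : R -> R) (t : R) :
  measurable_fun setT phi -> mu.-integrable period (EFin \o phi) ->
  lebesgue_pt phi t -> 0 < t < 2 * pi ->
  (\int[mu]_(s in period) (poisson r (s - t) * phi s))%R @[r --> (1 : R)^'-]
    --> 2 * pi * phi t.
Proof.
move=> mphi iphi lphi /andP[t0 t2].
pose g s := `|phi s - phi t|.
have g0 s : 0 <= g s by exact: normr_ge0.
have mg : measurable_fun setT g.
  by apply: measurableT_comp => //; exact: measurable_funB.
have ict (k : R) : mu.-integrable period (EFin \o (fun=> k)).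
  by apply: continuous_integrable_period => s; exact: cvg_cst.
have id : mu.-integrable period (EFin \o (fun s => phi s - phi t)).
  by have := @integrableB _ _ _ _ _ _ _ _ iphi (ict (phi t)); apply.
have ig : mu.-integrable period (EFin \o g) by exact: (integrable_norm id).
pose G := \int[mu]_(s in period) g s.
have G0 : 0 <= G by apply: Rintegral_ge0.
have k0 : 0 < cos 1 :> R := cos1_gt0 R.
pose K : R := 64 / cos 1 ^+ 2.
have K0 : 0 < K by rewrite divr_gt0// exprn_gt0.
apply/cvgrPdist_le => eps eps0.
(* Makes the near part [K * e] of [poisson_integral_le] equal to [eps / 2]. *)
pose e := eps / (2 * K).
have e0 : 0 < e by rewrite divr_gt0// mulr_gt0.
have [h1 h10 Hh1] := lebesgue_pt_near e0 lphi.
(* [h1 / 2] because the dyadic radii reach up to [2 * h]; 1 for the cosine bounds; the last two keep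
   [t] at distance at least [h] from the endpoints. *)
pose h := Num.min (Num.min (h1 / 2) 1) (Num.min t (2 * pi - t)).
have hh1 : h <= h1 / 2 by rewrite /h !ge_min lexx.
have h_1 : h <= 1 by rewrite /h !ge_min lexx ?orbT.
have ht : h <= t by rewrite /h !ge_min lexx ?orbT.
have htp : h <= 2 * pi - t by rewrite /h !ge_min lexx ?orbT.
have h0 : 0 < h.
  by rewrite /h !lt_min divr_gt0//= t0 ltr01 subr_gt0.
have ch : 0 < 1 - cos h.
  have := @one_minus_cos_ge R h; rewrite gtr0_norm// => /(_ h_1).
  by apply: lt_le_trans; rewrite divr_gt0// mulr_gt0// exprn_gt0.
(* Chosen so that [1 - r < del] makes the far part at most [eps / 2]; [G + 1] in place of [G] keeps
   the denominator positive. *)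
pose del := eps * (1 - cos h) / (4 * (G + 1)).
have G1 : 0 < G + 1 by rewrite ltr_wpDl.
have del0 : 0 < del by rewrite divr_gt0// mulr_gt0.
near=> r.
have r1 : r < 1 by near: r; exact: nbhs_left_lt.
have rh : 1 - h < r by near: r; apply: nbhs_left_gt; rewrite gtrBl.
have rd : 1 - del < r by near: r; apply: nbhs_left_gt; rewrite gtrBl.
have r2 : 2^-1 < r by near: r; apply: nbhs_left_gt; rewrite invf_lt1 ?ltr1n.
have r0 : 0 <= r by rewrite (le_trans _ (ltW r2)).
have mp : measurable_fun period (fun s => poisson r (s - t)).
  by apply: measurable_funTS; apply: continuous_measurable_fun; exact: continuous_poisson.
have iPf (f : R -> R) : mu.-integrable period (EFin \o f) ->
    mu.-integrable period (EFin \o (fun s => poisson r (s - t) * f s)).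
  move=> fi; apply: (@integrable_bounded_mul _ _ _ _ _ _ _ ((1 - r) ^- 2)) => //.
  by move=> s _; exact: poisson_norm_le.
rewrite distrC.
(* As the kernel has total mass [2 * pi], the error is the Poisson integral of [phi - phi t]. *)
have <- : \int[mu]_(s in period) (poisson r (s - t) * (phi s - phi t)) =
    \int[mu]_(s in period) (poisson r (s - t) * phi s) - 2 * pi * phi t.
  under eq_Rintegral do rewrite mulrBr.
  rewrite RintegralB//; [|exact: iPf|exact: (iPf (fun=> phi t))].
  rewrite RintegralZr//; last exact/continuous_integrable_period/continuous_poisson.
  by rewrite (Rintegral_poisson t r0 r1).
apply: (le_trans (le_normr_Rintegral _ (iPf _ id))) => //.
under eq_Rintegral do rewrite normrM (ger0_norm (poisson_ge0 _ r0 r1)).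
apply: (@le_trans _ _ (K * e + 2 * (1 - r) / (1 - cos h) * G)).
  apply: poisson_integral_le => //.
  - by move=> rho /andP[rho0 rhoh]; apply: Hh1; rewrite rho0/=; lra.
  - exact: ltW.
  - by rewrite h0.
  - by rewrite ht/=; lra.
  - by rewrite (ltW r2).
  - lra.
have -> : K * e = eps / 2 by rewrite /e; field; rewrite gt_eqF.
have : 2 * (1 - r) / (1 - cos h) * G <= eps / 2.
  apply: (@le_trans _ _ (2 * del / (1 - cos h) * (G + 1))).
    rewrite ler_pM//.
    - by rewrite divr_ge0 ?(ltW ch)// mulr_ge0// subr_ge0 ltW.
    - by rewrite ler_pM2r ?invr_gt0// ler_pM2l//; lra.
    - by rewrite lerDl.
  by rewrite le_eqVlt; apply/orP; left; apply/eqP; rewrite /del; field; rewrite !gt_eqF.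
lra.
Unshelve. all: by end_near.
Qed.

(** The radial function [v] is quantified inside the almost-everywhere clause and known only as the
    sum of the series, so the result applies to the real and to the imaginary part of a Taylor
    series along a radius. *)
Lemma fatou_radial_limit (al be : nat -> R) (N : nat -> nat) :
  fast_tails (fun n => al n ^+ 2 + be n ^+ 2) N ->
  exists phi : R -> R,
  [/\ measurable_fun setT phi,
   mu.-integrable period (EFin \o phi),
   (\int[mu]_(t in period) `|tpoly al be 0 (N k) t - phi t|)%R
     @[k --> \oo] --> (0 : R) &
   {ae mu, forall t, period t -> forall v : R -> R,
     (forall r, 0 <= r < 1 -> series (fun n => r ^+ n * wave al be n t) @ \oo --> v r) ->
     v r @[r --> (1 : R)^'-] --> phi t}].
Proof.
move=> fastN; have [kN _ _] := fastN.
have [psi [ipsi cpsi]] := riesz_fischer_L1 fastN.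
(* Extension by 0 off the period gives a function integrable on the whole line, to which Lebesgue
   differentiation applies. *)
pose phi := psi \_ period.
have phiE t : period t -> phi t = psi t by move=> pt; rewrite /phi patchE mem_set.
have iphiT : mu.-integrable setT (EFin \o phi).
  rewrite (_ : EFin \o phi = (EFin \o psi) \_ period) ?restrict_EFin//.
  by rewrite -restrict_EFin -integrable_mkcond.
have mphi : measurable_fun setT phi by apply/measurable_EFinP; case/integrableP : iphiT.
have iphi : mu.-integrable period (EFin \o phi).
  by apply: integrableS iphiT.
have cphi : (\int[mu]_(t in period) `|tpoly al be 0 (N k) t - phi t|)%R
     @[k --> \oo] --> (0 : R).
  under eq_fun do under eq_Rintegral => t /set_mem pt do rewrite phiE//.
  exact: cpsi.
exists phi; split => //.
(* The endpoints are discarded as null sets: the Poisson estimate is for [t] interior to the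
   period. *)
have ends (a : R) : {ae mu, forall t, t != a}.
  exists [set a]; split => //; first exact: lebesgue_measure_set1.
  by move=> t /= /negP; rewrite negbK => /eqP.
have leb := lebesgue_differentiation (open_integrable_locally openT iphiT).
have aeF := ae_filter_ringOfSetsType mu.
apply: (filterS3 _ _ (ends 0) (ends (2 * pi)) leb) => t t0 t2 lt pt v cv.
have tp : 0 < t < 2 * pi.
  move: pt; rewrite /= in_itv/= => /andP[h1 h2].
  by rewrite !lt_def t0 h1 eq_sym t2 h2.
have pic : 2 * pi != 0 :> R by rewrite mulf_neq0// gt_eqF// pi_gt0.
have : ((2 * pi)^-1 * \int[mu]_(s in period) (poisson r (s - t) * phi s))%R
    @[r --> (1 : R)^'-] --> (2 * pi)^-1 * (2 * pi * phi t).
  by apply: cvgM; [exact: cvg_cst|exact: poisson_cvg_lebesgue_pt].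
rewrite mulKf//; apply: cvg_trans; apply: near_eq_cvg.
near=> r.
have r1 : r < 1 by near: r; exact: nbhs_left_lt.
have r0 : 0 < r by near: r; exact: nbhs_left_gt.
rewrite (poisson_representation kN iphi cphi (ltW r0) r1 (cv _ _)) ?(ltW r0)//.
by rewrite mulKf.
Unshelve. all: by end_near.
Qed.

End fatou.

(** * Complex numbers *)

Section complex_lemmas.
Context {R : realType}.
Implicit Types (x y z w : R[i]) (a b e : R).

Lemma ReD x y : Re (x + y) = Re x + Re y. Proof. by case: x y => ? ? []. Qed.
Lemma ImD x y : Im (x + y) = Im x + Im y. Proof. by case: x y => ? ? []. Qed.
Lemma ReM x y : Re (x * y) = Re x * Re y - Im x * Im y. Proof. by case: x y => ? ? []. Qed.
Lemma ImM x y : Im (x * y) = Re x * Im y + Im x * Re y.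
Proof. by case: x y => ? ? [] ? ?. Qed.
Lemma ReN x : Re (- x) = - Re x. Proof. by case: x. Qed.
Lemma ImN x : Im (- x) = - Im x. Proof. by case: x. Qed.
Lemma ReJ x : Re (x^*) = Re x. Proof. by case: x. Qed.
Lemma ImJ x : Im (x^*) = - Im x. Proof. by case: x. Qed.
Lemma complex_eqE x y : Re x = Re y -> Im x = Im y -> x = y.
Proof. by case: x y => ? ? [] ? ? /= -> ->. Qed.

(** The norm of [R[i]] takes its values in [R[i]]; a modulus with values in [R] gives access to real
    order arguments. *)
Definition normc x : R := Num.sqrt (Re x ^+ 2 + Im x ^+ 2).

Lemma normcE x : `|x| = (normc x)%:C%C. Proof. exact: normc_def. Qed.

Lemma normc_ge0 x : 0 <= normc x. Proof. exact: sqrtr_ge0. Qed.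

Lemma sqr_normc x : normc x ^+ 2 = Re x ^+ 2 + Im x ^+ 2.
Proof. by rewrite sqr_sqrtr// addr_ge0 ?sqr_ge0. Qed.

Lemma normcM x y : normc (x * y) = normc x * normc y.
Proof. by apply: (@complexI R); rewrite rmorphM/= -!normcE normrM. Qed.

Lemma normcX x n : normc (x ^+ n) = normc x ^+ n.
Proof. by apply: (@complexI R); rewrite rmorphXn/= -!normcE normrX. Qed.

Lemma normcV x : normc x^-1 = (normc x)^-1.
Proof. by apply: (@complexI R); rewrite fmorphV/= -!normcE normfV. Qed.

Lemma normcJ x : normc (x^*) = normc x.
Proof. by rewrite /normc ReJ ImJ sqrrN. Qed.

Lemma normcD x y : normc (x + y) <= normc x + normc y.
Proof. by rewrite -lecR rmorphD/= -!normcE ler_normD. Qed.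

Lemma normcN x : normc (- x) = normc x.
Proof. by rewrite /normc ReN ImN !sqrrN. Qed.

Lemma normcB x y : normc (x - y) <= normc x + normc y.
Proof. by rewrite -(normcN y) normcD. Qed.

Lemma normc_eq0 x : (normc x == 0) = (x == 0).
Proof. by rewrite -(inj_eq (@complexI R)) -normcE normr_eq0. Qed.

Lemma normc_real a : normc a%:C%C = `|a|.
Proof. by rewrite /normc/= expr0n/= addr0 sqrtr_sqr. Qed.

Lemma normc1 : normc 1 = 1. Proof. by rewrite normc_real normr1. Qed.

Lemma normc_nat n : normc n%:R = n%:R.
Proof. by rewrite -(rmorph_nat (real_complex R)) normc_real normr_nat. Qed.

Lemma ler_Re_normc x : `|Re x| <= normc x.
Proof. by rewrite -lecR -normcE normc_ge_Re. Qed.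

Lemma ler_Im_normc x : `|Im x| <= normc x.
Proof. by rewrite -sqrtr_sqr ler_wsqrtr// lerDr sqr_ge0. Qed.

Lemma normc_le x : normc x <= `|Re x| + `|Im x|.
Proof.
rewrite -(ler_pXn2r (ltn0Sn 1)) ?nnegrE ?normc_ge0 ?addr_ge0//.
rewrite sqr_normc sqrrD !real_normK ?num_real// lerD2r lerDl.
by rewrite mulrn_wge0// mulr_ge0.
Qed.

Lemma diskP z : disk z <-> normc z < 1.
Proof. by rewrite /disk/= normcE -[1]/(1%:C)%C ltcR. Qed.

Lemma gt0_complexE (eps : R[i]) : 0 < eps -> 0 < Re eps /\ eps = (Re eps)%:C%C.
Proof. by case: eps => a b; rewrite ltcE/= => /andP[/eqP -> ?]. Qed.

Section convergence.
Context {T : Type} {F : set_system T} {FF : Filter F}.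
Implicit Types f : T -> R[i].

Lemma cvg_normcP f z : f @ F --> z <-> normc (f x - z) @[x --> F] --> (0 : R).
Proof.
split=> [/cvgrPdist_lt h|/cvgrPdist_lt h]; apply/cvgrPdist_lt => e e0.
  have : 0 < e%:C%C by rewrite ltcR.
  move=> /h; apply: filterS => x; rewrite normcE ltcR sub0r normrN.
  by rewrite ger0_norm ?normc_ge0// -normcN opprB.
have [e1 ->] := gt0_complexE e0.
have := h _ e1; apply: filterS => x; rewrite normcE ltcR sub0r normrN.
by rewrite ger0_norm ?normc_ge0// -normcN opprB.
Qed.

Lemma cvg_Re f z : f @ F --> z -> Re (f x) @[x --> F] --> Re z.
Proof.
move=> /cvg_normcP; apply: cvg_dist_le; apply: nearW => x.
by rewrite -ReN -ReD ler_Re_normc.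
Qed.

Lemma cvg_Im f z : f @ F --> z -> Im (f x) @[x --> F] --> Im z.
Proof.
move=> /cvg_normcP; apply: cvg_dist_le; apply: nearW => x.
by rewrite -ImN -ImD ler_Im_normc.
Qed.

Lemma cvg_complex f a b : Re (f x) @[x --> F] --> a -> Im (f x) @[x --> F] --> b ->
  f @ F --> Complex a b.
Proof.
move=> fa fb; apply/cvg_normcP.
have : (`|Re (f x) - a| + `|Im (f x) - b|) @[x --> F] --> (0 : R).
  rewrite -[X in _ --> X]addr0; apply: cvgD; apply/norm_cvg0P/subr_cvg0; exact.
apply: cvg_dist_le; apply: nearW => x.
rewrite subr0 ger0_norm ?normc_ge0//.
by apply: (le_trans (normc_le _)); rewrite ReD ImD ReN ImN.
Qed.

End convergence.

Lemma Re_sum (I : Type) (r : seq I) (P : pred I) (f : I -> R[i]) :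
  Re (\sum_(i <- r | P i) f i) = \sum_(i <- r | P i) Re (f i).
Proof. exact: (big_morph _ ReD). Qed.

Lemma Im_sum (I : Type) (r : seq I) (P : pred I) (f : I -> R[i]) :
  Im (\sum_(i <- r | P i) f i) = \sum_(i <- r | P i) Im (f i).
Proof. exact: (big_morph _ ImD). Qed.

Lemma normc_sum (I : Type) (r : seq I) (P : pred I) (f : I -> R[i]) :
  normc (\sum_(i <- r | P i) f i) <= \sum_(i <- r | P i) normc (f i).
Proof.
elim/big_ind2 : _ => //; first by rewrite normc_real normr0.
by move=> x a y b xa yb; apply: le_trans (normcD _ _) (lerD xa yb).
Qed.

Lemma normed_series_cvg (c : nat -> R[i]) (B : R) :
  (forall N, \sum_(0 <= n < N) normc (c n) <= B) -> exists l : R[i], series c @ \oo --> l.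
Proof.
move=> cB.
have key (p : nat -> R) : (forall n, `|p n| <= normc (c n)) -> cvgn (series p).
  move=> pc; apply: normed_cvg; apply: nondecreasing_is_cvgn.
    apply/nondecreasing_seqP => n.
    by rewrite [leRHS]seriesSr lerDl; exact: normr_ge0.
  exists B => _ [n _ <-]; apply: le_trans (cB n).
  by rewrite /series/=; apply: ler_sum => i _; exact: pc.
have /cvg_ex[/= a ca] := key (fun n => Re (c n)) (fun n => ler_Re_normc _).
have /cvg_ex[/= b cb] := key (fun n => Im (c n)) (fun n => ler_Im_normc _).
exists (Complex a b); apply: cvg_complex.
- by under eq_fun do rewrite /series/= Re_sum.
- by under eq_fun do rewrite /series/= Im_sum.
Qed.

End complex_lemmas.

(* [c] is dominated by the convolution of [b] with [rho ^ n]. *)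
Lemma sum_le_geometric_filter (R : realFieldType) (rho : R) (b c : nat -> R) N :
  0 <= rho < 1 -> (forall n, 0 <= c n) -> c 0%N <= b 0%N ->
  (forall n, c n.+1 <= b n.+1 + rho * c n) ->
  \sum_(0 <= n < N) c n <= (\sum_(0 <= n < N) b n) / (1 - rho).
Proof.
move=> /andP[r0 r1] c0 cb0 cb.
rewrite ler_pdivlMr ?subr_gt0//.
case: N => [|N]; first by rewrite !big_nil mul0r.
pose Sc n := \sum_(0 <= i < n) c i; pose Sb n := \sum_(0 <= i < n) b i.
have ScS n : Sc n.+1 = Sc n + c n by rewrite /Sc big_nat_recr.
have SbS n : Sb n.+1 = Sb n + b n by rewrite /Sb big_nat_recr.
rewrite -/(Sc _) -/(Sb _).
(* Summing the recursive inequality gives [Sc <= Sb + rho * Sc] up to a shift of index, which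
   nonnegativity of [c] absorbs. *)
have h : Sc N.+1 <= Sb N.+1 + rho * Sc N.
  elim: N => [|N IH]; first by rewrite ScS SbS /Sc /Sb !big_nil; lra.
  by rewrite (ScS N.+1) (SbS N.+1) [X in rho * X]ScS; have := cb N; lra.
have : rho * Sc N <= rho * Sc N.+1 by rewrite ler_wpM2l// ScS lerDl.
lra.
Qed.

(** * Integrals of complex functions on the circle *)

Section ae_invariance.
Import HBNNSimple.
Context d (T : measurableType d) (R : realType) (mu : {measure set T -> \bar R}).
Local Open Scope ereal_scope.

(** The integral is a supremum over simple functions; one that lies below [f], once set to 0 on [N],
    lies below [g] and keeps its integral. *)
Lemma ge0_integral_ae_le (N : set T) (f g : T -> \bar R) :
  measurable N -> mu N = 0 -> (forall x, 0 <= f x) -> (forall x, 0 <= g x) ->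
  (forall x, ~ N x -> f x <= g x) -> \int[mu]_x f x <= \int[mu]_x g x.
Proof.
move=> mN N0 f0 g0 fg; rewrite (ge0_integralTE mu f0) (ge0_integralTE mu g0).
apply: ge_ereal_sup => _ [h /= hf <-]; apply: ereal_sup_ubound.
have mNC : measurable (~` N) by exact: measurableC.
exists (proj_nnsfun h mNC) => /=.
  move=> x; rewrite /= mindicE; case: (boolP (x \in ~` N)) => xN.
    by rewrite mulr1; apply: le_trans (hf x) (fg _ _); rewrite inE in xN.
  by rewrite mulr0.
rewrite -!integralT_nnsfun; apply: ge0_ae_eq_integral => //.
- by apply/measurable_EFinP; exact: measurable_funP.
- by apply/measurable_EFinP; exact: measurable_funP.
- by move=> x _; rewrite lee_fin.
- by move=> x _; rewrite lee_fin.
- exists N; split => // x /= => /not_implyP[_] hx; apply: contrapT => Nx; apply: hx.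
  by rewrite /= mindicE mem_set// mulr1.
Qed.

(* Boundary functions are not known to be Borel measurable. The integral of a
   nonnegative function is a supremum over the simple functions below it, so it is
   insensitive to null sets without any measurability assumption. *)
Lemma ae_eq_integral_nonmeasurable (D : set T) (f g : T -> \bar R) :
  {ae mu, forall x, D x -> f x = g x} ->
  \int[mu]_(x in D) f x = \int[mu]_(x in D) g x.
Proof.
move=> [N [mN N0 fgN]].
have fg x : ~ N x -> D x -> f x = g x.
  by move=> Nx Dx; apply: contrapT => h; apply: Nx; apply: fgN => /= /(_ Dx).
have key (p q : T -> \bar R) : (forall x, 0 <= p x) -> (forall x, 0 <= q x) ->
    (forall x, ~ N x -> p x = q x) -> \int[mu]_x p x = \int[mu]_x q x.
  move=> p0 q0 pq; apply/eqP; rewrite eq_le.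
  by apply/andP; split; apply: (@ge0_integral_ae_le N) => // x Nx; rewrite pq.
rewrite integral_mkcond [RHS]integral_mkcond integralE [RHS]integralE.
have fgD x : ~ N x -> (f \_ D) x = (g \_ D) x.
  by move=> Nx; rewrite !patchE; case: ifPn => // /set_mem; exact: fg.
congr (_ - _); apply: key => // x Nx.
- by rewrite !funeposE fgD.
- by rewrite !funenegE fgD.
Qed.

End ae_invariance.

Section circle_integrals.
Context {R : realType}.
Local Notation mu := (@lebesgue_measure R).
Local Notation period := (`[0 : R, 2 * pi]%classic).
Implicit Types (F G : R -> R[i]) (c : R[i]).

Lemma circle_integral_ae F G :
  {ae mu, forall t, period t -> F t = G t} ->
  circle_integral F = circle_integral G.
Proof.
move=> [N [mN N0 FG]]; rewrite /circle_integral /Rintegral.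
by congr (Complex (_ * fine _) (_ * fine _)); apply: ae_eq_integral_nonmeasurable;
  exists N; split => // t /= /not_implyP[pt h]; apply: FG => /= /(_ pt) FGt;
  apply: h; rewrite FGt.
Qed.

Lemma eq_circle_integral F G : (forall t, F t = G t) ->
  circle_integral F = circle_integral G.
Proof. by move=> /funext ->. Qed.

Definition cintegrable F :=
  mu.-integrable period (EFin \o (fun t => Re (F t))) /\
  mu.-integrable period (EFin \o (fun t => Im (F t))).

Definition cmeasurable F :=
  measurable_fun period (fun t => Re (F t)) /\
  measurable_fun period (fun t => Im (F t)).

Let integrableDR (f g : R -> R) : mu.-integrable period (EFin \o f) ->
  mu.-integrable period (EFin \o g) ->
  mu.-integrable period (EFin \o (fun t => f t + g t)).
Proof. by move=> fi gi; have := @integrableD _ _ _ _ _ _ _ _ fi gi; apply. Qed.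

Let integrableZR (f : R -> R) k : mu.-integrable period (EFin \o f) ->
  mu.-integrable period (EFin \o (fun t => k * f t)).
Proof. by move=> fi; have := @integrableZl _ _ _ _ _ _ k _ fi; apply. Qed.

Let eq_integrableR (f g : R -> R) : (forall t, f t = g t) ->
  mu.-integrable period (EFin \o g) -> mu.-integrable period (EFin \o f).
Proof. by move=> /funext ->. Qed.

Lemma cintegrableD F G : cintegrable F -> cintegrable G ->
  cintegrable (fun t => F t + G t).
Proof.
move=> [F1 F2] [G1 G2]; split.
- by apply: (eq_integrableR (fun=> ReD _ _)); exact: integrableDR.
- by apply: (eq_integrableR (fun=> ImD _ _)); exact: integrableDR.
Qed.

Lemma cintegrable_mul G F (B : R) : cmeasurable G ->
  (forall t, period t -> normc (G t) <= B) -> cintegrable F ->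
  cintegrable (fun t => G t * F t).
Proof.
move=> [G1 G2] GB [F1 F2].
have bR t : period t -> `|Re (G t)| <= B by move=> /GB; apply: le_trans (ler_Re_normc _).
have bI t : period t -> `|Im (G t)| <= B by move=> /GB; apply: le_trans (ler_Im_normc _).
have bm (g f : R -> R) : measurable_fun period g -> (forall t, period t -> `|g t| <= B) ->
    mu.-integrable period (EFin \o f) ->
    mu.-integrable period (EFin \o (fun t => g t * f t)).
  by move=> mg gB fi; apply: (@integrable_bounded_mul _ _ _ _ _ _ _ B).
split.
- apply: (eq_integrableR (fun=> ReM _ _)); apply: integrableDR; first exact: bm.
  apply: (eq_integrableR (fun=> esym (mulN1r _))); apply: integrableZR; exact: bm.
- by apply: (eq_integrableR (fun=> ImM _ _)); apply: integrableDR; exact: bm.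
Qed.

Lemma cintegrableZ c F : cintegrable F -> cintegrable (fun t => c * F t).
Proof.
by apply: (@cintegrable_mul _ _ (normc c)) => //.
Qed.

Lemma circle_integralD F G : cintegrable F -> cintegrable G ->
  circle_integral (fun t => F t + G t) = circle_integral F + circle_integral G.
Proof.
move=> [F1 F2] [G1 G2]; apply: complex_eqE; rewrite ?ReD ?ImD /= -mulrDr.
- by under eq_Rintegral do rewrite ReD; rewrite RintegralD.
- by under eq_Rintegral do rewrite ImD; rewrite RintegralD.
Qed.

Lemma circle_integralZ c F : cintegrable F ->
  circle_integral (fun t => c * F t) = c * circle_integral F.
Proof.
move=> [F1 F2]; apply: complex_eqE; rewrite ?ReM ?ImM /=.
- under eq_Rintegral do rewrite ReM.
  rewrite RintegralB//; try exact: integrableZR.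
  by rewrite !RintegralZl//; ring.
- under eq_Rintegral do rewrite ImM.
  rewrite RintegralD//; try exact: integrableZR.
  by rewrite !RintegralZl//; ring.
Qed.

Lemma circle_integral0 : circle_integral (fun=> 0 : R[i]) = 0.
Proof.
by rewrite /circle_integral /= !Rintegral_cst// !mul0r !mulr0.
Qed.

Lemma cintegrable_cst c : cintegrable (fun=> c).
Proof.
by split; apply: continuous_integrable_period => t; exact: cvg_cst.
Qed.

Lemma cintegrable_sum (f : nat -> R -> R[i]) N : (forall n, cintegrable (f n)) ->
  cintegrable (fun t => \sum_(0 <= n < N) f n t).
Proof.
move=> fi; elim: N => [|N IH].
  rewrite (_ : (fun t => _) = (fun=> 0)); first exact: cintegrable_cst.
  by apply/funext => t; rewrite big_nil.
rewrite (_ : (fun t => _) = (fun t => \sum_(0 <= n < N) f n t + f N t)).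
  exact: cintegrableD.
by apply/funext => t; rewrite big_nat_recr.
Qed.

Lemma circle_integral_sum (f : nat -> R -> R[i]) N : (forall n, cintegrable (f n)) ->
  circle_integral (fun t => \sum_(0 <= n < N) f n t) =
  \sum_(0 <= n < N) circle_integral (f n).
Proof.
move=> fi; elim: N => [|N IH].
  rewrite big_nil -[RHS]circle_integral0; apply: eq_circle_integral => t.
  by rewrite big_nil.
rewrite (@eq_circle_integral _ (fun t => \sum_(0 <= n < N) f n t + f N t)); last first.
  by move=> t; rewrite big_nat_recr.
by rewrite circle_integralD ?big_nat_recr//= ?IH//; exact: cintegrable_sum.
Qed.

(** The real and the imaginary part are bounded separately, hence [B + B]. It is there to show that
    a family of moments is bounded, for which any constant will do. *)
Lemma circle_integral_norm_le F (B : R) : cintegrable F ->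
  (forall t, period t -> normc (F t) <= B) -> normc (circle_integral F) <= B + B.
Proof.
move=> [F1 F2] FB; have p0 : 0 < 2 * pi :> R by rewrite mulr_gt0 ?pi_gt0.
have key (f : R -> R) : mu.-integrable period (EFin \o f) ->
    (forall t, period t -> `|f t| <= B) ->
    `|(2 * pi)^-1 * \int[mu]_(t in period) f t| <= B.
  move=> fi fB; rewrite normrM gtr0_norm ?invr_gt0// ler_pdivrMl//.
  apply: (le_trans (le_normr_Rintegral _ fi)) => //.
  have -> : 2 * pi * B = \int[mu]_(t in period) B.
    by rewrite Rintegral_cst//= measure_period/= mulrC.
  apply: le_Rintegral => //; first exact: (integrable_norm fi).
  by apply: continuous_integrable_period => t; exact: cvg_cst.
apply: (le_trans (normc_le _)); apply: lerD; apply: key => // t /FB.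
- exact: le_trans (ler_Re_normc _).
- exact: le_trans (ler_Im_normc _).
Qed.

Definition cvg_circle_L1 (f : nat -> R -> R[i]) F :=
  [/\ forall k, cintegrable (f k), cintegrable F,
      (\int[mu]_(t in period) `|Re (f k t) - Re (F t)|)%R @[k --> \oo] --> (0 : R) &
      (\int[mu]_(t in period) `|Im (f k t) - Im (F t)|)%R @[k --> \oo] --> (0 : R)].

Lemma cvg_circle_integral_mul G (B : R) (f : nat -> R -> R[i]) F : cmeasurable G ->
  (forall t, period t -> normc (G t) <= B) -> cvg_circle_L1 f F ->
  circle_integral (fun t => G t * f k t) @[k --> \oo] -->
  circle_integral (fun t => G t * F t).
Proof.
move=> [G1 G2] GB [fi [F1 F2] cR cI].
have bR t : period t -> `|Re (G t)| <= B by move=> /GB; apply: le_trans (ler_Re_normc _).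
have bI t : period t -> `|Im (G t)| <= B by move=> /GB; apply: le_trans (ler_Im_normc _).
have bm (g p : R -> R) : measurable_fun period g -> (forall t, period t -> `|g t| <= B) ->
    mu.-integrable period (EFin \o p) ->
    mu.-integrable period (EFin \o (fun t => g t * p t)).
  by move=> mg gB ip; apply: (@integrable_bounded_mul _ _ _ _ _ _ _ B).
have conv (g : R -> R) (p : nat -> R -> R) (q : R -> R) : measurable_fun period g ->
    (forall t, period t -> `|g t| <= B) ->
    (forall k, mu.-integrable period (EFin \o p k)) ->
    mu.-integrable period (EFin \o q) ->
    (\int[mu]_(t in period) `|p k t - q t|)%R @[k --> \oo] --> (0 : R) ->
    (\int[mu]_(t in period) (g t * p k t))%R @[k --> \oo] -->
    (\int[mu]_(t in period) (g t * q t))%R.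
  move=> mg gB ip iq cpq.
  by apply: (@cvg_Rintegral_bounded_mul _ _ _ _ _ _ _ B).
have fR k : mu.-integrable period (EFin \o (fun t => Re (f k t))) by case: (fi k).
have fI k : mu.-integrable period (EFin \o (fun t => Im (f k t))) by case: (fi k).
have ER K : cintegrable K -> \int[mu]_(t in period) Re (G t * K t) =
    \int[mu]_(t in period) (Re (G t) * Re (K t)) -
    \int[mu]_(t in period) (Im (G t) * Im (K t)).
  move=> [K1 K2]; under eq_Rintegral do rewrite ReM.
  by rewrite RintegralB//; exact: bm.
have EI K : cintegrable K -> \int[mu]_(t in period) Im (G t * K t) =
    \int[mu]_(t in period) (Re (G t) * Im (K t)) +
    \int[mu]_(t in period) (Im (G t) * Re (K t)).
  move=> [K1 K2]; under eq_Rintegral do rewrite ImM.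
  by rewrite RintegralD//; exact: bm.
apply: cvg_complex => /=; apply: cvgM; do ?[exact: cvg_cst].
- rewrite ER//; under eq_fun do rewrite ER//.
  by apply: cvgB; exact: conv.
- rewrite EI//; under eq_fun do rewrite EI//.
  by apply: cvgD; exact: conv.
Qed.

End circle_integrals.

(** * Boundary functions *)

Section hardy_boundary.
Context {R : realType}.
Local Notation mu := (@lebesgue_measure R).
Local Notation period := (`[0 : R, 2 * pi]%classic).
Implicit Types (F : R -> R[i]) (a : nat -> R[i]) (f : R[i] -> R[i]).

Lemma polarX (r t : R) n : polar r t ^+ n = polar (r ^+ n) (n%:R * t).
Proof.
elim: n => [|n IH]; first by rewrite !expr0 /polar mul0r cos0 sin0 !mul1r.
rewrite exprSr IH -natr1 mulrDl mul1r; apply: complex_eqE.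
  by rewrite ReM /= cosD exprSr; ring.
by rewrite ImM /= sinD exprSr; ring.
Qed.

Lemma normc_polar (r t : R) : normc (polar r t) = `|r|.
Proof.
by rewrite /normc/= !exprMn -mulrDr cos2Dsin2 mulr1 sqrtr_sqr.
Qed.

Lemma disk_polar (r t : R) : 0 <= r < 1 -> disk (polar r t).
Proof. by move=> /andP[r0 r1]; apply/diskP; rewrite normc_polar ger0_norm. Qed.

Lemma Re_polar_term a n (r t : R) : Re (a n * polar r t ^+ n) =
  r ^+ n * wave (fun n => Re (a n)) (fun n => - Im (a n)) n t.
Proof. by rewrite polarX ReM /= /wave; ring. Qed.

Lemma Im_polar_term a n (r t : R) : Im (a n * polar r t ^+ n) =
  r ^+ n * wave (fun n => Im (a n)) (fun n => Re (a n)) n t.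
Proof. by rewrite polarX ImM /= /wave; ring. Qed.

Definition psum a N (t : R) : R[i] := \sum_(0 <= n < N) a n * polar 1 t ^+ n.

Lemma Re_psum a N t :
  Re (psum a N t) = tpoly (fun n => Re (a n)) (fun n => - Im (a n)) 0 N t.
Proof.
by rewrite Re_sum; apply: eq_bigr => n _; rewrite Re_polar_term expr1n mul1r.
Qed.

Lemma Im_psum a N t :
  Im (psum a N t) = tpoly (fun n => Im (a n)) (fun n => Re (a n)) 0 N t.
Proof.
by rewrite Im_sum; apply: eq_bigr => n _; rewrite Im_polar_term expr1n mul1r.
Qed.

Lemma cintegrable_psum a N : cintegrable (psum a N).
Proof.
split; apply: continuous_integrable_period.
- by rewrite (funext (Re_psum a N)); exact: continuous_tpoly.
- by rewrite (funext (Im_psum a N)); exact: continuous_tpoly.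
Qed.

Lemma series_sqr_normc a : cvgn [series `|a n| ^+ 2]_n ->
  cvgn (series (fun n => Re (a n) ^+ 2 + Im (a n) ^+ 2)).
Proof.
move=> /cvg_ex[/= l /cvg_Re cl]; apply/cvg_ex; exists (Re l).
apply: cvg_trans cl; apply: near_eq_cvg; apply: nearW => n.
rewrite /series/= Re_sum; apply: eq_bigr => k _.
by rewrite normcE -rmorphXn/= sqr_normc.
Qed.

Definition has_taylor f a :=
  cvgn [series `|a n| ^+ 2]_n /\
  forall z, disk z -> [series a n * z ^+ n]_n @ \oo --> f z.

Definition radial_limits f F := {ae mu, forall t, period t ->
  f (polar r t) @[r --> (1 : R)^'-] --> F t}.

Lemma hardy2_boundary f a : has_taylor f a -> exists (N : nat -> nat) F,
  [/\ forall k, (k <= N k)%N, cmeasurable F,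
      cvg_circle_L1 (fun k => psum a (N k)) F & radial_limits f F].
Proof.
move=> [a2 af].
(* One subsequence serves both parts: for [Re] and for [Im] the squared coefficients add up to the
   same [|a n|^2]. *)
have [N fastN] := exists_fast_tails (series_sqr_normc a2).
have kN : forall k, (k <= N k)%N by case: fastN.
have fastR : fast_tails (fun n => Re (a n) ^+ 2 + (- Im (a n)) ^+ 2) N.
  by rewrite (_ : (fun n => _) = (fun n => Re (a n) ^+ 2 + Im (a n) ^+ 2))//;
    apply/funext => n; rewrite sqrrN.
have fastI : fast_tails (fun n => Im (a n) ^+ 2 + Re (a n) ^+ 2) N.
  by rewrite (_ : (fun n => _) = (fun n => Re (a n) ^+ 2 + Im (a n) ^+ 2))//;
    apply/funext => n; rewrite addrC.
have [p [mp ip cp radp]] := fatou_radial_limit fastR.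
have [q [mq iq cq radq]] := fatou_radial_limit fastI.
exists N, (fun t => Complex (p t) (q t)); split => //.
- by split; exact: measurable_funTS.
- split => //; first by move=> k; exact: cintegrable_psum.
  + by under eq_fun do under eq_Rintegral do rewrite Re_psum; exact: cp.
  + by under eq_fun do under eq_Rintegral do rewrite Im_psum; exact: cq.
have aeF := ae_filter_ringOfSetsType mu.
apply: (filterS2 _ _ radp radq) => t hp hq pt.
apply: cvg_complex.
- apply: hp => // r r01.
  have cr : Re (\sum_(0 <= k < n) a k * polar r t ^+ k) @[n --> \oo] --> Re (f (polar r t)).
    by apply: cvg_Re; exact: (af _ (disk_polar t r01)).
  apply: cvg_trans cr; apply: near_eq_cvg; apply: nearW => n.
  by rewrite /series/= Re_sum; apply: eq_bigr => k _; rewrite Re_polar_term.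
- apply: hq => // r r01.
  have cr : Im (\sum_(0 <= k < n) a k * polar r t ^+ k) @[n --> \oo] --> Im (f (polar r t)).
    by apply: cvg_Im; exact: (af _ (disk_polar t r01)).
  apply: cvg_trans cr; apply: near_eq_cvg; apply: nearW => n.
  by rewrite /series/= Im_sum; apply: eq_bigr => k _; rewrite Im_polar_term.
Qed.

Lemma boundaryE f t (l : R[i]) : f (polar r t) @[r --> (1 : R)^'-] --> l -> boundary f t = l.
Proof. by move=> fl; apply: cvg_lim. Qed.

(** The boundary function of [u] is to act as a multiplier under L^1 limits, so a representative
    bounded at every point is produced; the radial limit and unimodularity remain almost-everywhere
    statements. *)
Lemma inner_boundary (u : R[i] -> R[i]) a : inner_function u -> has_taylor u a ->
  exists (N : nat -> nat) U,
  [/\ forall k, (k <= N k)%N, cmeasurable U, forall t, normc (U t) <= 1,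
      cvg_circle_L1 (fun k => psum a (N k)) U &
      {ae mu, forall t, period t ->
        (u (polar r t) @[r --> (1 : R)^'-] --> U t) /\ normc (U t) = 1}].
Proof.
move=> [_ _ uni] ua; have [N [F [kN [mR mI] [fi [FR FI] cR cI] rad]]] := hardy2_boundary ua.
(* [F] is unimodular only almost everywhere: cut it off to get a bounded function. *)
pose A := [set t | period t /\ Re (F t) ^+ 2 + Im (F t) ^+ 2 <= 1].
pose U t : R[i] := if t \in A then F t else 0.
have mA : measurable A.
  have mq : measurable_fun period (fun t => Re (F t) ^+ 2 + Im (F t) ^+ 2).
    by apply: measurable_funD; exact: measurable_funX.
  have := @mq _ `]-oo, 1]%classic; rewrite /A => h.
  rewrite (_ : [set t | _] = period `&`
     (fun t => Re (F t) ^+ 2 + Im (F t) ^+ 2) @^-1` `]-oo, 1]%classic).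
    exact: h.
  by apply/seteqP; split => t /=; rewrite in_itv/=.
have aeF := ae_filter_ringOfSetsType mu.
have aeU : {ae mu, forall t, period t ->
    (u (polar r t) @[r --> (1 : R)^'-] --> F t) /\ normc (F t) = 1 /\ U t = F t}.
  apply: (filterS2 _ _ rad uni) => t h1 [l ul l1] pt.
  have Fl : F t = l by apply: (cvg_unique _ (h1 pt) ul).
  split; first exact: h1.
  have n1 : normc (F t) = 1 by apply: (@complexI R); rewrite -normcE Fl l1.
  split => //; rewrite /U; case: ifPn => // /negP []; rewrite inE; split => //.
  by rewrite -sqr_normc n1 expr1n.
have URe t : Re (U t) = ((fun t => Re (F t)) \_ A) t.
  by rewrite /U patchE; case: ifP.
have UIm t : Im (U t) = ((fun t => Im (F t)) \_ A) t.
  by rewrite /U patchE; case: ifP.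
have Ap : A `<=` period by move=> t [].
have mperiod : measurable period by exact: measurable_itv.
have mres (g : R -> R) : measurable_fun period g -> measurable_fun period (g \_ A).
  move=> mg; apply: (measurable_restrict g mA mperiod).1.
  by apply: (measurable_funS mperiod _ mg); exact: subIsetl.
have mUR : measurable_fun period (fun t => Re (U t)).
  by rewrite (funext URe); exact: mres.
have mUI : measurable_fun period (fun t => Im (U t)).
  by rewrite (funext UIm); exact: mres.
have U1 t : normc (U t) <= 1.
  rewrite /U; case: ifPn => [|_]; last by rewrite normc_real normr0.
  rewrite inE => -[_ h]; rewrite -(ler_pXn2r (ltn0Sn 1)) ?nnegrE ?normc_ge0//.
  by rewrite sqr_normc expr1n.
have iU (g : R -> R) : measurable_fun period g -> (forall t, `|g t| <= 1) ->
    mu.-integrable period (EFin \o g).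
  move=> mg g1; have := @integrable_bounded_mul _ _ _ mu period mperiod g 1 (cst 1) mg.
  rewrite (_ : (fun x => g x * cst 1 x) = g); last by apply/funext => x; rewrite mulr1.
  apply => //; apply: continuous_integrable_period => t; exact: cvg_cst.
have aeint (g h : R -> R) : {ae mu, forall t, period t -> g t = h t} ->
    \int[mu]_(t in period) g t = \int[mu]_(t in period) h t.
  move=> gh; rewrite /Rintegral; congr fine; apply: ae_eq_integral_nonmeasurable.
  by apply: (filterS _ gh) => t h1 /h1 ->.
exists N, U; split => //.
- split => //.
  + split; apply: iU => // t; apply: le_trans (U1 t).
    * exact: ler_Re_normc.
    * exact: ler_Im_normc.
  + apply: cvg_trans cR; apply: near_eq_cvg; apply: nearW => k; apply: aeint.
    by apply: (filterS _ aeU) => t h /h [_ [_ ->]].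
  + apply: cvg_trans cI; apply: near_eq_cvg; apply: nearW => k; apply: aeint.
    by apply: (filterS _ aeU) => t h /h [_ [_ ->]].
- by apply: (filterS _ aeU) => t h /h [h1 [h2 ->]].
Qed.

End hardy_boundary.

(** * Taylor series *)

Section taylor_series.
Context {R : realType}.
Implicit Types (a b : nat -> R[i]) (f g : R[i] -> R[i]) (c w z : R[i]).

Lemma sqr_summable_bounded a : cvgn [series `|a n| ^+ 2]_n ->
  exists B, forall N, \sum_(0 <= n < N) normc (a n) ^+ 2 <= B.
Proof.
move=> /series_sqr_normc ca.
exists (limn (series (fun n => Re (a n) ^+ 2 + Im (a n) ^+ 2))) => N.
under eq_bigr do rewrite sqr_normc.
apply: (nondecreasing_cvgn_le _ ca); apply/nondecreasing_seqP => n.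
by rewrite [leRHS]seriesSr lerDl addr_ge0 ?sqr_ge0.
Qed.

Lemma bounded_sqr_summable a B :
  (forall N, \sum_(0 <= n < N) normc (a n) ^+ 2 <= B) -> cvgn [series `|a n| ^+ 2]_n.
Proof.
move=> aB; apply/cvg_ex; apply: (@normed_series_cvg _ _ B) => N.
apply: le_trans (aB N); apply: ler_sum => n _.
by rewrite /= normcE -rmorphXn/= normc_real ger0_norm// sqr_ge0.
Qed.

Lemma sqr_summable_coef_bounded a : cvgn [series `|a n| ^+ 2]_n ->
  exists2 A : R, 0 < A & forall n, normc (a n) <= A.
Proof.
move=> /sqr_summable_bounded[B aB].
have B0 : 0 <= B by have := aB 0%N; rewrite big_nil.
exists (B + 1) => [|n]; first by rewrite ltr_wpDl.
have h : normc (a n) ^+ 2 <= B.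
  apply: le_trans (aB n.+1); rewrite big_nat_recr//= lerDr.
  by apply: sumr_ge0 => k _; exact: sqr_ge0.
by have := sqr_ge0 (normc (a n) - 1); have := sqr_ge0 (normc (a n)); lra.
Qed.

(* The Taylor coefficients of [f / (1 - c z)] when those of [f] are [a]. *)
Fixpoint geometric_filter c a n : R[i] :=
  if n is m.+1 then a n + c * geometric_filter c a m else a 0%N.

(** Multiplication by [1 - c * z] telescopes the sum and leaves one boundary term, which tends to 0
    in the disk when the coefficients are bounded. *)
Lemma geometric_filter_sum c a z N :
  (1 - c * z) * \sum_(0 <= n < N.+1) geometric_filter c a n * z ^+ n =
  \sum_(0 <= n < N.+1) a n * z ^+ n - c * geometric_filter c a N * z ^+ N.+1.
Proof.
elim: N => [|N IH]; first by rewrite !big_nat1 /= !expr0 expr1; ring.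
rewrite big_nat_recr//= mulrDr IH [in RHS]big_nat_recr//= !exprS.
by ring.
Qed.

Lemma normcX_cvg0 z : disk z -> normc (z ^+ n) @[n --> \oo] --> (0 : R).
Proof.
move=> /diskP z1; under eq_fun do rewrite normcX.
by apply: cvg_expr; rewrite ger0_norm ?normc_ge0.
Qed.

(* Square summability: [(x + rho y)^2 <= x^2 / (1 - rho) + rho y^2] by convexity. *)
Lemma has_taylor_geometric f a c : disk c -> has_taylor f a ->
  has_taylor (fun z => f z / (1 - c * z)) (geometric_filter c a).
Proof.
move=> /diskP c1 fa; have [/sqr_summable_bounded[B aB] af] := fa.
pose rho := normc c; have r0 : 0 <= rho := normc_ge0 c.
have r1 : 0 < 1 - rho by rewrite subr_gt0.
pose b := geometric_filter c a.
pose a' n := normc (a n) ^+ 2 / (1 - rho).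
have bB N : \sum_(0 <= n < N) normc (b n) ^+ 2 <= B / (1 - rho) / (1 - rho).
  apply: (@le_trans _ _ ((\sum_(0 <= n < N) a' n) / (1 - rho))).
    apply: sum_le_geometric_filter => //.
    - by rewrite r0 -subr_gt0.
    - by move=> n; exact: sqr_ge0.
    - by rewrite /a' ler_pdivlMr// ler_piMr ?sqr_ge0// gerBl.
    move=> n; have e : (1 - rho) * a' n.+1 = normc (a n.+1) ^+ 2.
      by rewrite /a' mulrC divfK// gt_eqF.
    rewrite -(ler_pM2l r1) (mulrDr _ (a' _)) e.
    have h : normc (b n.+1) <= normc (a n.+1) + rho * normc (b n).
      by rewrite /b/=; apply: le_trans (normcD _ _) _; rewrite normcM.
    have h2 : normc (b n.+1) ^+ 2 <= (normc (a n.+1) + rho * normc (b n)) ^+ 2.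
      by apply: lerXn2r; rewrite ?nnegrE ?addr_ge0 ?mulr_ge0 ?normc_ge0.
    (* [1 - rho] times the defect in the convexity inequality is exactly this quantity. *)
    have h3 : 0 <= rho * (normc (a n.+1) - (1 - rho) * normc (b n)) ^+ 2.
      by rewrite mulr_ge0// sqr_ge0.
    have := ler_wpM2l (ltW r1) h2.
    move: (normc (a _)) (normc (b n.+1)) (normc (b n)) h3 => x y v h3.
    lra.
  by rewrite ler_pdivrMr// divfK ?gt_eqF// -mulr_suml ler_pdivrMr// divfK ?gt_eqF.
have cb := bounded_sqr_summable bB.
split=> [|z zd]; first exact: cb.
have [A A0 bA] := sqr_summable_coef_bounded cb.
have z1 := diskP z; have cz0 : 1 - c * z != 0.
  rewrite subr_eq0; apply/eqP => cz; have := normcM c z.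
  rewrite -cz normc1 => h; have := z1.1 zd; have := normc_ge0 z; move: c1 r0 h.
  rewrite /rho; move: (normc c) (normc z) => x y; nra.
have tail0 : (fun n => c * b n * z ^+ n.+1) @ \oo --> (0 : R[i]).
  apply/cvg_normcP.
  have : (A * normc (z ^+ n)) @[n --> \oo] --> (0 : R).
    by rewrite -[X in _ --> X](mulr0 A); apply: cvgM; [exact: cvg_cst|exact: normcX_cvg0].
  apply: cvg_dist_le; apply: nearW => n; rewrite !subr0 ger0_norm ?normc_ge0//.
  rewrite exprS mulrA !normcM ler_wpM2r ?normc_ge0//.
  have := bA n; have := normc_ge0 (b n); have := normc_ge0 z; have := z1.1 zd.
  move: c1 r0; rewrite /rho; move: (normc c) (normc z) (normc (b n)) => x y v.
  move=> x1 x0 y1 y0 v0 vA.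
  have h1 : 0 <= v * (1 - x) by rewrite mulr_ge0//; lra.
  have h2 : 0 <= x * v * (1 - y) by rewrite !mulr_ge0//; lra.
  lra.
have lim1 : (\sum_(0 <= k < n.+1) a k * z ^+ k - c * b n * z ^+ n.+1) / (1 - c * z)
    @[n --> \oo] --> (f z - 0) / (1 - c * z).
  apply: cvgM; last exact: cvg_cst.
  apply: cvgB; last exact: tail0.
  exact: (cvg_subseq leqnSn (af z zd)).
rewrite subr0 in lim1; rewrite -cvg_shiftS.
suff -> : (fun n => [series b n * z ^+ n]_n n.+1) =
    (fun n => (\sum_(0 <= k < n.+1) a k * z ^+ k - c * b n * z ^+ n.+1) / (1 - c * z)).
  exact: lim1.
apply/funext => n; rewrite -geometric_filter_sum mulrC mulKf//.
Qed.

Lemma hardy2_taylor f : hardy2 f -> exists a, has_taylor f a.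
Proof. by move=> [a a2 af]; exists a. Qed.

Lemma has_taylor_hardy2 f a : has_taylor f a -> hardy2 f.
Proof. by move=> [a2 af]; exists a. Qed.

Lemma hardy2_geometric f c : disk c -> hardy2 f -> hardy2 (fun z => f z / (1 - c * z)).
Proof.
move=> c1 /hardy2_taylor[a fa].
exact: has_taylor_hardy2 (has_taylor_geometric c1 fa).
Qed.

Lemma hardy2_1 : hardy2 (fun=> 1 : R[i]).
Proof.
pose a n : R[i] := (n == 0%N)%:R.
have sum1 (F : nat -> R[i]) N : (forall n, F n.+1 = 0) ->
    \sum_(0 <= n < N.+1) F n = F 0%N.
  by move=> F0; rewrite big_nat_recl//= big1 ?addr0.
exists a => [|z zd].
  apply: (@bounded_sqr_summable _ 1) => -[|N]; first by rewrite big_nil.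
  rewrite big_nat_recl//= big1 ?addr0; last by move=> n _; rewrite normc_real normr0 expr0n.
  by rewrite normc1 expr1n.
rewrite -cvg_shiftS.
rewrite (_ : (fun n => _) = (fun=> 1)); first exact: cvg_cst.
apply/funext => n.
by rewrite /series/= sum1/= ?mulr1// => k; rewrite /a/= mul0r.
Qed.

(* [n^2 <= (n + 1) (n + 2)], and [(n + 1) (n + 2) / 2 * rho ^ n] is the threefold
   convolution of [rho ^ n] with itself. *)
Lemma sum_sqr_geometric_le (rho : R) N : 0 <= rho < 1 ->
  \sum_(0 <= n < N) n%:R ^+ 2 * rho ^+ n <= 2 / (1 - rho) / (1 - rho) / (1 - rho).
Proof.
move=> rho01; have /andP[r0 r1] := rho01.
have d0 : 0 < 1 - rho by rewrite subr_gt0.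
pose c0 n : R := (n == 0%N)%:R.
pose c1 n : R := rho ^+ n.
pose c2 n : R := n.+1%:R * rho ^+ n.
pose c3 n : R := (n.+1 * n.+2)%N%:R * rho ^+ n / 2.
have pos n : 0 <= rho ^+ n by rewrite exprn_ge0.
have s1 : \sum_(0 <= n < N) c1 n <= (\sum_(0 <= n < N) c0 n) / (1 - rho).
  by apply: sum_le_geometric_filter => // n; rewrite /c1 /c0/= exprS add0r.
have s2 : \sum_(0 <= n < N) c2 n <= (\sum_(0 <= n < N) c1 n) / (1 - rho).
  apply: sum_le_geometric_filter => // [n||n].
  - by rewrite /c2 mulr_ge0.
  - by rewrite /c2 /c1 mul1r.
  - by rewrite /c2 /c1 -(natr1 n.+1) exprS; lra.
have s3 : \sum_(0 <= n < N) c3 n <= (\sum_(0 <= n < N) c2 n) / (1 - rho).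
  apply: sum_le_geometric_filter => // [n||n].
  - by rewrite /c3 divr_ge0// mulr_ge0.
  - by rewrite /c3 /c2 !expr0 !mulr1 mul1n; lra.
  - by rewrite /c3 /c2 !natrM -(natr1 n.+2) -(natr1 n.+1) exprS; lra.
have s0 : \sum_(0 <= n < N) c0 n <= 1.
  case: N {s1 s2 s3} => [|N]; first by rewrite big_nil.
  by rewrite big_nat_recl//= big1// addr0.
apply: (@le_trans _ _ (\sum_(0 <= n < N) (2 * c3 n))).
  apply: ler_sum => n _; rewrite /c3 mulrCA divff// mulr1 ler_wpM2r//.
  by rewrite -natrX ler_nat; lia.
rewrite -mulr_sumr -!mulrA ler_pM2l// !mulrA.
have v0 : 0 < (1 - rho)^-1 by rewrite invr_gt0.
apply: (le_trans s3); rewrite ler_pM2r//.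
apply: (le_trans s2); rewrite ler_pM2r//.
by apply: (le_trans s1); rewrite -[leRHS]mul1r ler_pM2r.
Qed.

End taylor_series.

(** * Complex derivatives of Taylor series *)

Section taylor_derivative.
Context {R : realType}.
Implicit Types (a b : nat -> R[i]) (f g : R[i] -> R[i]) (c w z : R[i]).

(* The remainders satisfy [t (n+1) = z t n + n w^(n-1) (z - w)^2]; the factor
   [rho ^ 2] avoids the exponent [n - 2]. *)
Lemma power_remainder (z w : R[i]) (rho : R) n : normc z <= rho -> normc w <= rho ->
  rho ^+ 2 * normc (z ^+ n - w ^+ n - n%:R * w ^+ n.-1 * (z - w)) <=
  n%:R ^+ 2 * rho ^+ n * normc (z - w) ^+ 2.
Proof.
move=> zr wr; have r0 : 0 <= rho := le_trans (normc_ge0 z) zr.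
elim: n => [|n IH].
  by rewrite !expr0 mul0r mul0r subrr subr0 normc_real normr0 mulr0 expr0n/= !mul0r.
have -> : z ^+ n.+1 - w ^+ n.+1 - n.+1%:R * w ^+ n.+1.-1 * (z - w) =
    z * (z ^+ n - w ^+ n - n%:R * w ^+ n.-1 * (z - w)) + n%:R * w ^+ n.-1 * (z - w) ^+ 2.
  case: n {IH} => [|n]; first by rewrite /= !expr0 !expr1; ring.
  by rewrite /= -(natr1 n.+1) !exprS; ring.
set t := _ - _ - _; set e := normc (z - w).
have e0 : 0 <= e ^+ 2 := sqr_ge0 e.
have h1 : rho ^+ 2 * normc (z * t) <= n%:R ^+ 2 * rho ^+ n.+1 * e ^+ 2.
  rewrite normcM mulrCA (exprS rho n).
  apply: (@le_trans _ _ (rho * (rho ^+ 2 * normc t))).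
    by rewrite ler_wpM2r// mulr_ge0 ?sqr_ge0 ?normc_ge0.
  by rewrite [leRHS](_ : _ = rho * (n%:R ^+ 2 * rho ^+ n * e ^+ 2)); [exact: ler_wpM2l|ring].
have h2 : rho ^+ 2 * normc (n%:R * w ^+ n.-1 * (z - w) ^+ 2) <= n%:R * rho ^+ n.+1 * e ^+ 2.
  rewrite !normcM !normcX normc_nat -/e mulrA ler_wpM2r//.
  case: n {IH t h1} => [|n]; first by rewrite !mul0r mulr0.
  rewrite /= mulrCA; apply: ler_wpM2l => //.
  rewrite -[n.+2]/(2 + n)%N exprD; apply: ler_wpM2l; first exact: sqr_ge0.
  by apply: lerXn2r; rewrite ?nnegrE ?normc_ge0.
apply: (@le_trans _ _ (n%:R ^+ 2 * rho ^+ n.+1 * e ^+ 2 + n%:R * rho ^+ n.+1 * e ^+ 2)).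
  apply: le_trans (lerD h1 h2); rewrite -mulrDr ler_wpM2l ?sqr_ge0//.
  exact: normcD.
rewrite -!mulrDl ler_wpM2r// ler_wpM2r ?exprn_ge0//.
rewrite -natr1 sqrrD expr1n mulr1 -natrX; have : 0 <= n%:R :> R by []. 
by lra.
Qed.

Lemma is_derive_quadratic f w (d : R[i]) (K del : R) : 0 < del ->
  (forall z, normc (z - w) < del -> normc (f z - f w - d * (z - w)) <= K * normc (z - w) ^+ 2) ->
  is_derive w 1 f d.
Proof.
move=> del0 fK.
have cv : (h^-1 *: ((f \o shift w) (h *: (1 : R[i])) - f w)) @[h --> (0 : R[i])^'] --> d.
  apply/cvg_normcP.
  have Kn : (K * normc h) @[h --> (0 : R[i])^'] --> (0 : R).
    rewrite -[X in _ --> X](mulr0 K); apply: cvgM; first exact: cvg_cst.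
    have : id @ (0 : R[i])^' --> (0 : R[i]) by exact: cvg_within.
    move=> /cvg_normcP; apply: cvg_trans; apply: near_eq_cvg; apply: nearW => h.
    by rewrite subr0.
  have hdel : \forall h \near (0 : R[i])^', `|h| < del%:C%C.
    apply: cvg_within; have /cvgrPdist_lt := @cvg_id _ (nbhs (0 : R[i])).
    move=> /(_ del%:C%C); rewrite ltcR => /(_ del0); apply: filterS => x.
    by rewrite sub0r normrN.
  apply: cvg_dist_le Kn; near=> h.
  have h0 : h != 0 by near: h; exact: nbhs_dnbhs_neq.
  have hd : normc h < del by rewrite -ltcR -normcE; near: h; exact: hdel.
  rewrite subr0 ger0_norm ?normc_ge0//=.
  have e : h^-1 *: (f (h *: (1 : R[i]) + w) - f w) - d =
      h^-1 * (f (h + w) - f w - d * (h + w - w)).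
    rewrite addrK /GRing.scale/= mulr1 [RHS]mulrBr; congr (_ - _).
    by rewrite mulrC mulfK.
  rewrite e normcM normcV.
  have nh : 0 < normc h by rewrite lt_def normc_eq0 h0 normc_ge0.
  rewrite ler_pdivrMl// mulrCA -expr2.
  by have := fK (h + w); rewrite addrK; apply.
apply: DeriveDef; first by apply/cvg_ex; exists d.
exact: cvg_lim cv.
Unshelve. all: by end_near.
Qed.

Lemma taylor_derivative f a w : has_taylor f a -> disk w ->
  exists d, [series n%:R * a n * w ^+ n.-1]_n @ \oo --> d /\ is_derive w 1 f d.
Proof.
move=> [ca af] wd.
have [A A0 aA] := sqr_summable_coef_bounded ca.
have w1 := (diskP w).1 wd; have w0 := normc_ge0 w.
(* The midpoint of [|w|] and 1: the disk of radius [rho - normc w] about [w] stays inside radius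
   [rho < 1], where the bounds of [power_remainder] are summable. *)
pose rho := (1 + normc w) / 2.
have r01 : 0 < rho < 1 by rewrite /rho; lra.
have /andP[r0 r1] := r01.
have wr : normc w <= rho by rewrite /rho; lra.
pose M := 2 / (1 - rho) / (1 - rho) / (1 - rho).
have MN N : \sum_(0 <= n < N) n%:R ^+ 2 * rho ^+ n <= M.
  by apply: sum_sqr_geometric_le; rewrite (ltW r0).
have [d dlim] : exists d : R[i], [series n%:R * a n * w ^+ n.-1]_n @ \oo --> d.
  apply: (@normed_series_cvg _ _ (A * rho^-1 * M)) => N.
  apply: (@le_trans _ _ (\sum_(0 <= n < N) A * rho^-1 * (n%:R ^+ 2 * rho ^+ n))).
    apply: ler_sum => n _; rewrite /= !normcM normcX normc_nat.
    case: n => [|n]; first by rewrite !mul0r expr0n/= !mul0r mulr0.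
    rewrite (exprS rho n) [leRHS](_ : _ = A * (n.+1%:R ^+ 2 * rho ^+ n)); last first.
      by field; rewrite gt_eqF.
    rewrite [X in X * _ <= _]mulrC -mulrA ler_pM ?normc_ge0 ?mulr_ge0 ?exprn_ge0//.
    rewrite ler_pM ?exprn_ge0//.
      by rewrite expr2 ler_peMr// ler1n.
    by apply: lerXn2r; rewrite ?nnegrE ?normc_ge0 ?(ltW r0).
  by rewrite -mulr_sumr ler_wpM2l// mulr_ge0 ?invr_ge0 ?(ltW A0) ?(ltW r0).
exists d; split; first exact: dlim.
apply: (@is_derive_quadratic _ _ _ (A * M / rho ^+ 2) (rho - normc w)).
  by rewrite /rho; lra.
move=> z zw.
have zr : normc z <= rho.
  have := normcD (z - w) w; rewrite subrK; lra.
have zd : disk z by apply/diskP; apply: le_lt_trans zr r1.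
have r2 : 0 < rho ^+ 2 by rewrite exprn_gt0.
pose S N := \sum_(0 <= n < N) a n * z ^+ n - \sum_(0 <= n < N) a n * w ^+ n -
    \sum_(0 <= n < N) n%:R * a n * w ^+ n.-1 * (z - w).
have lim1 : S @ \oo --> f z - f w - d * (z - w).
  apply: cvgB; first by apply: cvgB; [exact: (af z zd)|exact: (af w wd)].
  under eq_fun do rewrite -mulr_suml.
  by apply: cvgM; [exact: dlim|exact: cvg_cst].
have bnd N : normc (S N) <= A * M / rho ^+ 2 * normc (z - w) ^+ 2.
  rewrite /S -!sumrB; apply: le_trans (normc_sum _ _ _) _.
  rewrite -(ler_pM2l r2) mulr_sumr.
  have -> : rho ^+ 2 * (A * M / rho ^+ 2 * normc (z - w) ^+ 2) = M * (A * normc (z - w) ^+ 2).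
    by field; rewrite gt_eqF.
  apply: (@le_trans _ _ ((\sum_(0 <= n < N) n%:R ^+ 2 * rho ^+ n) * (A * normc (z - w) ^+ 2))).
    rewrite mulr_suml; apply: ler_sum => n _.
    have -> : a n * z ^+ n - a n * w ^+ n - n%:R * a n * w ^+ n.-1 * (z - w) =
        a n * (z ^+ n - w ^+ n - n%:R * w ^+ n.-1 * (z - w)) by ring.
    rewrite normcM mulrCA.
    rewrite [leRHS](_ : _ = A * (n%:R ^+ 2 * rho ^+ n * normc (z - w) ^+ 2)); last by ring.
    apply: ler_pM => //; rewrite ?normc_ge0//.
      by rewrite mulr_ge0 ?normc_ge0// ltW.
    exact: power_remainder.
  by rewrite ler_wpM2r// mulr_ge0 ?sqr_ge0// ltW.
(* The bound on all partial remainders passes to their limit: if the limit exceeded it by [e], some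
   [S N] within [e] of the limit would exceed it too. *)
rewrite leNgt; apply/negP => gap.
pose e := normc (f z - f w - d * (z - w)) - A * M / rho ^+ 2 * normc (z - w) ^+ 2.
have e0 : 0 < e by rewrite subr_gt0.
have [N _ /(_ N (leqnn N))/=] : \forall N \near \oo, `|f z - f w - d * (z - w) - S N| < e%:C%C.
  by have /cvgrPdist_lt := lim1; apply; rewrite ltcR.
rewrite normcE ltcR => h.
have := normcD (f z - f w - d * (z - w) - S N) (S N); rewrite subrK.
by have := bnd N; move: h; rewrite /e; lra.
Qed.

(** The last series exhibits [(z f)'(w)] in the form in which the moments [n.+1 * w ^+ n] of the
    squared Szego kernel produce it. *)
Lemma taylor_derive1_id f a w : has_taylor f a -> disk w ->
  exists d, [/\ is_derive w 1 f d, derive1 (fun z => z * f z) w = f w + w * d,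
    [series n%:R * a n * w ^+ n]_n @ \oo --> w * d &
    [series n.+1%:R * a n * w ^+ n]_n @ \oo --> f w + w * d].
Proof.
move=> fa wd; have [d [dlim fd]] := taylor_derivative fa wd.
have [_ af] := fa.
have l1 : [series n%:R * a n * w ^+ n]_n @ \oo --> w * d.
  rewrite (_ : [series n%:R * a n * w ^+ n]_n =
      (fun N => w * [series n%:R * a n * w ^+ n.-1]_n N)).
    by apply: cvgM; [exact: cvg_cst|exact: dlim].
  apply/funext => N; rewrite /series/= mulr_sumr; apply: eq_bigr => -[|n] _.
    by rewrite !mul0r mulr0.
  by rewrite /= exprS; ring.
exists d; split; [exact: fd| |exact: l1|].
- rewrite derive1E.
  have hh := is_deriveM (is_derive_id w 1) fd.
  by rewrite (@derive_val _ _ _ _ _ _ _ hh) addrC /GRing.scale/= mulr1.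
- rewrite (_ : [series n.+1%:R * a n * w ^+ n]_n =
      (fun N => [series a n * w ^+ n]_n N + [series n%:R * a n * w ^+ n]_n N)).
    by apply: cvgD; [exact: (af w wd)|exact: l1].
  apply/funext => N; rewrite /series/= -big_split/=; apply: eq_bigr => n _.
  by rewrite -natr1; ring.
Qed.

End taylor_derivative.

(** * Pairing with the squared Szego kernel *)

Section szego_moments.
Context {R : realType}.
Local Notation mu := (@lebesgue_measure R).
Local Notation period := (`[0 : R, 2 * pi]%classic).
Implicit Types (F G : R -> R[i]) (w c : R[i]).

Let e (t : R) : R[i] := polar 1 t.

Lemma continuous_cmeasurable F : continuous F -> cmeasurable F.
Proof.
move=> cF; split; apply: measurable_funTS; apply: continuous_measurable_fun => t.
- exact: cvg_Re (cF t).
- exact: cvg_Im (cF t).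
Qed.

Lemma continuous_cintegrable F : continuous F -> cintegrable F.
Proof.
move=> cF; split; apply: continuous_integrable_period => t.
- exact: cvg_Re (cF t).
- exact: cvg_Im (cF t).
Qed.

Lemma continuous_polar1 : continuous (polar 1 : R -> R[i]).
Proof.
move=> t; apply: cvg_complex => /=; apply: cvgM; do ?[exact: cvg_cst].
- exact: continuous_cos.
- exact: continuous_sin.
Qed.

Lemma continuous_conj F : continuous F -> continuous (fun t => (F t)^*).
Proof.
move=> cF; rewrite (_ : (fun t => _) = fun t => Complex (Re (F t)) (- Im (F t))).
  move=> t; apply: cvg_complex => /=; first exact: cvg_Re (cF t).
  by apply: cvgN; exact: cvg_Im (cF t).
by apply/funext => t; apply: complex_eqE; rewrite ?ReJ ?ImJ.
Qed.

Lemma continuousMc F G : continuous F -> continuous G -> continuous (fun t => F t * G t).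
Proof. by move=> cF cG t; apply: cvgM; [exact: cF|exact: cG]. Qed.

Lemma continuousXc F n : continuous F -> continuous (fun t => F t ^+ n).
Proof.
move=> cF; elim: n => [|n IH]; first by move=> t; exact: cvg_cst.
have -> : (fun t => F t ^+ n.+1) = (fun t => F t * F t ^+ n).
  by apply/funext => t; rewrite exprS.
exact: continuousMc.
Qed.

Lemma normc_polar1 t : normc (e t) = 1.
Proof. by rewrite normc_polar normr1. Qed.

Lemma mul_conj_unit (z : R[i]) : normc z = 1 -> z * z^* = 1.
Proof.
move=> z1; have := sqr_normc z; rewrite z1 expr1n => h.
apply: complex_eqE; rewrite ?ReM ?ImM ReJ ImJ/=; first by rewrite h; ring.
by ring.
Qed.

Lemma circle_integral_polarX n : circle_integral (fun t => e t ^+ n) = (n == 0%N)%:R.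
Proof.
have p0 : 2 * pi != 0 :> R by rewrite mulf_neq0// gt_eqF// pi_gt0.
case: n => [|n].
  apply: complex_eqE => /=.
    by rewrite Rintegral_cst//= measure_period/= mul1r mulVf.
  by rewrite Rintegral_cst//= mul0r mulr0.
apply: complex_eqE => /=.
  under eq_Rintegral do rewrite /e polarX expr1n/= mul1r -[X in cos X]addr0.
  by rewrite Rintegral_cos_nat// mulr0.
under eq_Rintegral do rewrite /e polarX expr1n/= mul1r -cosBpihalf.
by rewrite Rintegral_cos_nat// mulr0.
Qed.

Lemma circle_integral_conj F : cintegrable F ->
  circle_integral (fun t => (F t)^*) = (circle_integral F)^*.
Proof.
move=> [F1 F2]; apply: complex_eqE; rewrite ?ReJ ?ImJ /=.
  by under eq_Rintegral do rewrite ReJ.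
under eq_Rintegral do rewrite ImJ -mulN1r.
by rewrite RintegralZl// mulN1r mulrN.
Qed.

Lemma cintegrable_polarX n : cintegrable (fun t => e t ^+ n).
Proof. by apply/continuous_cintegrable/continuousXc; exact: continuous_polar1. Qed.

Lemma circle_integral_conj_polarX n :
  circle_integral (fun t => (e t)^* ^+ n) = (n == 0%N)%:R.
Proof.
under eq_circle_integral do rewrite -rmorphXn/=.
rewrite circle_integral_conj; last exact: cintegrable_polarX.
by rewrite circle_integral_polarX rmorph_nat.
Qed.

(* Geometric series without sums: [V = G / (1 - w conj e)] with [e = e^{it}]. Its
   moments of negative frequency satisfy [al j = w * al j.+1] and are bounded, so
   they vanish. *)
Lemma circle_moment_rec w G V B : disk w -> continuous G -> continuous V ->
  (forall t, normc (V t) <= B) ->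
  (forall t, V t = G t + w * (e t)^* * V t) ->
  (forall j, circle_integral (fun t => (e t)^* ^+ j * G t) = (j == 0%N)%:R) ->
  (forall j, circle_integral (fun t => (e t)^* ^+ j * V t) = (j == 0%N)%:R) /\
  (forall n, circle_integral (fun t => e t ^+ n.+1 * V t) =
    circle_integral (fun t => e t ^+ n.+1 * G t) +
    w * circle_integral (fun t => e t ^+ n * V t)).
Proof.
move=> wd cG cV VB VG GJ.
have ce : continuous e by exact: continuous_polar1.
have cc : continuous (fun t => (e t)^*) by exact: continuous_conj.
have int1 j F : continuous F -> cintegrable (fun t => (e t)^* ^+ j * F t).
  by move=> cF; exact/continuous_cintegrable/(continuousMc (continuousXc (n := j) cc) cF).
have int2 j F : continuous F -> cintegrable (fun t => e t ^+ j * F t).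
  by move=> cF; exact/continuous_cintegrable/(continuousMc (continuousXc (n := j) ce) cF).
pose al j := circle_integral (fun t => (e t)^* ^+ j * V t).
have alS j : al j = (j == 0%N)%:R + w * al j.+1.
  rewrite -GJ /al -circle_integralZ; last exact: int1.
  rewrite -circle_integralD; [|exact: int1|apply: cintegrableZ; exact: int1].
  by apply: eq_circle_integral => t; rewrite {1}VG exprS; ring.
have al0 j : al j.+1 = 0.
  apply/eqP; rewrite -normc_eq0; apply/eqP.
  apply: (@geometric_decay_eq0 _ (normc w) (B + B) (fun j => normc (al j.+1))).
  - exact: normc_ge0.
  - exact/diskP.
  - move=> n; rewrite ger0_norm ?normc_ge0//; apply: circle_integral_norm_le.
      exact: int1.
    by move=> t _; rewrite normcM normcX normcJ normc_polar1 expr1n mul1r.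
  - by move=> n; rewrite (alS n.+1) add0r normcM.
split=> [[|j]|n].
- by rewrite -/(al 0%N) alS al0 mulr0 addr0.
- exact: al0.
- rewrite -circle_integralZ; last exact: int2.
  rewrite -circle_integralD; [|exact: int2|apply: cintegrableZ; exact: int2].
  apply: eq_circle_integral => t; rewrite {1}VG mulrDr; congr (_ + _).
  (* [e * conj e = 1] lowers the power: [e ^+ n.+1 * w * conj e * V] is [w * e ^+ n * V]. *)
  have := mul_conj_unit (normc_polar1 t); rewrite exprS.
  move: (e t) ((e t)^*) => x y xy.
  transitivity ((x * y) * (w * (x ^+ n * V t))); first by ring.
  by rewrite xy mul1r.
Qed.

Lemma one_sub_mul_gt w z : disk w -> normc z <= 1 -> 1 - normc w <= normc (1 - w * z).
Proof.
move=> /diskP w1 z1; have := normcB (1 - w * z) (- (w * z)).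
rewrite opprK subrK normc1 normcN normcM.
have : 0 <= normc w * (1 - normc z) by rewrite mulr_ge0 ?normc_ge0// subr_ge0.
lra.
Qed.

Lemma one_sub_mul_neq0 w z : disk w -> normc z <= 1 -> 1 - w * z != 0.
Proof.
move=> wd z1; rewrite -normc_eq0 gt_eqF//.
by apply: lt_le_trans (one_sub_mul_gt wd z1); rewrite subr_gt0; exact/diskP.
Qed.

(* The conjugate of the boundary function of [1 / (1 - conj w z)]. *)
Definition szego w (t : R) : R[i] := (1 - w * (polar 1 t)^*)^-1.

Lemma conj_polar1_le t : normc ((e t)^*) <= 1.
Proof. by rewrite normcJ normc_polar1. Qed.

Lemma continuous_szego w : disk w -> continuous (szego w).
Proof.
move=> wd t; apply: cvgV; first exact: one_sub_mul_neq0 (conj_polar1_le t).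
apply: cvgB; first exact: cvg_cst.
apply: cvgM; first exact: cvg_cst.
exact: (continuous_conj continuous_polar1).
Qed.

Lemma szego_norm_le w t : disk w -> normc (szego w t) <= (1 - normc w)^-1.
Proof.
move=> wd; have h := one_sub_mul_gt wd (conj_polar1_le t).
have w1 := (diskP w).1 wd; have w2 : 0 < 1 - normc w by rewrite subr_gt0.
by rewrite normcV lef_pV2 ?posrE// (lt_le_trans w2).
Qed.

Lemma szego_rec w t : disk w -> szego w t = 1 + w * (e t)^* * szego w t.
Proof.
move=> wd; have := one_sub_mul_neq0 wd (conj_polar1_le t).
by rewrite /szego -/(e t) => h; field.
Qed.

(** [circle_moment_rec] applies twice: [V = 1 + w * conj e * V] gives the moments [w ^+ n] of [V],
    and [V ^+ 2 = V + w * conj e * V ^+ 2] gives those of [V ^+ 2] through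
    [b n.+1 = w ^+ n.+1 + w * b n] with [b 0 = 1]. *)
Lemma circle_integral_szego_sqr w n : disk w ->
  circle_integral (fun t => e t ^+ n * szego w t ^+ 2) = n.+1%:R * w ^+ n.
Proof.
move=> wd; pose V := szego w; have cV : continuous V := continuous_szego wd.
have VB t : normc (V t) <= (1 - normc w)^-1 := szego_norm_le t wd.
have c1 : continuous ((fun=> 1) : R -> R[i]) by move=> t; exact: cvg_cst.
have cV2 : continuous (fun t => V t ^+ 2) := continuousXc (n := 2) cV.
have V2B t : normc (V t ^+ 2) <= (1 - normc w)^-1 ^+ 2.
  by rewrite normcX lerXn2r ?nnegrE ?normc_ge0// (le_trans _ (VB t))// normc_ge0.
have J1 j : circle_integral (fun t => (e t)^* ^+ j * 1) = (j == 0%N)%:R.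
  by under eq_circle_integral do rewrite mulr1; exact: circle_integral_conj_polarX.
have rec1 t : V t = 1 + w * (e t)^* * V t := szego_rec t wd.
have [J2 S1] := circle_moment_rec wd c1 cV VB rec1 J1.
have rec2 t : V t ^+ 2 = V t + w * (e t)^* * V t ^+ 2.
  by rewrite expr2 {1}rec1; ring.
have [J3 S2] := circle_moment_rec wd cV cV2 V2B rec2 J2.
have V0 m : circle_integral (fun t => e t ^+ m * V t) = w ^+ m.
  elim: m => [|m IH]; first by have := J2 0%N.
  rewrite S1 IH exprS.
  under eq_circle_integral do rewrite mulr1.
  by rewrite circle_integral_polarX add0r.
elim: n => [|n IH]; first by have := J3 0%N => /= ->; rewrite mulr1.
by rewrite S2 IH V0 -(natr1 n.+1) exprS; ring.
Qed.

End szego_moments.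

Lemma cvg_seq_unique (R : realType) (v : nat -> R[i]) (l1 l2 : R[i]) :
  v @ \oo --> l1 -> v @ \oo --> l2 -> l1 = l2.
Proof. by move=> h1 h2; apply: (cvg_unique _ h1 h2). Qed.

(** * Pairings of boundary functions with the squared Szego kernel *)

Section pairings.
Context {R : realType}.
Variables (w : R[i]).
Hypothesis wd : disk w.
Implicit Types (F U : R -> R[i]) (f u : R[i] -> R[i]) (a b : nat -> R[i]).

Let X t : R[i] := szego w t ^+ 2.
Let B : R := (1 - normc w)^-1 ^+ 2.
Local Notation period := (`[0 : R, 2 * pi]%classic).

Lemma continuous_szego_sqr : continuous X.
Proof. exact: (continuousXc (n := 2) (continuous_szego wd)). Qed.

Lemma szego_sqr_norm_le t : normc (X t) <= B.
Proof.
have h := szego_norm_le t wd.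
by rewrite normcX lerXn2r ?nnegrE ?normc_ge0// (le_trans _ h)// normc_ge0.
Qed.

Lemma circle_integral_psum G a N :
  (forall n, cintegrable (fun t => G t * polar 1 t ^+ n)) ->
  circle_integral (fun t => G t * psum a N t) =
  \sum_(0 <= n < N) a n * circle_integral (fun t => G t * polar 1 t ^+ n).
Proof.
move=> iG.
have iaG n : cintegrable (fun t => a n * (G t * polar 1 t ^+ n)) by exact: cintegrableZ.
transitivity (circle_integral (fun t => \sum_(0 <= n < N) a n * (G t * polar 1 t ^+ n))).
  apply: eq_circle_integral => t; rewrite /psum mulr_sumr.
  by apply: eq_bigr => n _; rewrite mulrCA.
by rewrite circle_integral_sum//; apply: eq_bigr => n _; rewrite circle_integralZ.
Qed.

(* For [m = 0] the right-hand side is [(z f)'(w)], with [d = f'(w)]. *)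
Lemma pairing_shift f a (N : nat -> nat) F m d : has_taylor f a ->
  (forall k, (k <= N k)%N) -> cvg_circle_L1 (fun k => psum a (N k)) F ->
  [series n%:R * a n * w ^+ n]_n @ \oo --> w * d ->
  [series n.+1%:R * a n * w ^+ n]_n @ \oo --> f w + w * d ->
  circle_integral (fun t => X t * polar 1 t ^+ m * F t) =
  w ^+ m * (f w + w * d + m%:R * f w).
Proof.
move=> [_ af] kN cF _ l2.
have ce := @continuous_polar1 R.
have cX := continuous_szego_sqr.
have cG n : continuous (fun t => X t * polar 1 t ^+ n).
  exact: (continuousMc cX (continuousXc (n := n) ce)).
have GB t : period t -> normc (X t * polar 1 t ^+ m) <= B.
  by move=> _; rewrite normcM normcX normc_polar1 expr1n mulr1 szego_sqr_norm_le.
have lim1 := cvg_circle_integral_mul (continuous_cmeasurable (cG m)) GB cF.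
apply: (cvg_seq_unique lim1).
have l0 := af w wd.
(* The monomial of degree [n + m] contributes [(n + m).+1 * w ^+ (n + m)]; splitting the factor as
   [n.+1 + m] separates [(z f)'(w)] from [m * f w]. *)
have -> : (fun k => circle_integral (fun t => X t * polar 1 t ^+ m * psum a (N k) t)) =
    (fun k => w ^+ m * (\sum_(0 <= n < N k) n.+1%:R * a n * w ^+ n +
        m%:R * \sum_(0 <= n < N k) a n * w ^+ n)).
  apply/funext => k; rewrite circle_integral_psum; last first.
    move=> n; apply: continuous_cintegrable.
    exact: (continuousMc (cG m) (continuousXc (n := n) ce)).
  rewrite mulr_sumr -big_split/= mulr_sumr; apply: eq_bigr => n _.
  rewrite (@eq_circle_integral _ _ (fun t => polar 1 t ^+ (n + m) * szego w t ^+ 2)).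
    by rewrite circle_integral_szego_sqr// -addSn natrD exprD; ring.
  by move=> t; rewrite exprD /X; ring.
apply: cvgM; first exact: cvg_cst.
apply: cvgD; first exact: (cvg_subseq kN l2).
by apply: cvgM; [exact: cvg_cst|exact: (cvg_subseq kN l0)].
Qed.

(* The right-hand side is [(z u f)'(w)]. *)
Lemma pairing_mul f a u au (N Nu : nat -> nat) F U d du :
  has_taylor f a -> has_taylor u au ->
  (forall k, (k <= N k)%N) -> (forall k, (k <= Nu k)%N) ->
  cvg_circle_L1 (fun k => psum a (N k)) F ->
  cvg_circle_L1 (fun k => psum au (Nu k)) U ->
  cmeasurable U -> (forall t, normc (U t) <= 1) ->
  [series n%:R * a n * w ^+ n]_n @ \oo --> w * d ->
  [series n%:R * au n * w ^+ n]_n @ \oo --> w * du ->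
  [series n.+1%:R * au n * w ^+ n]_n @ \oo --> u w + w * du ->
  circle_integral (fun t => X t * U t * F t) =
  f w * (u w + w * du) + u w * (w * d).
Proof.
move=> [_ af] ua kN kNu cF cU mU U1 l1 lu1 lu2.
have ce := @continuous_polar1 R.
have cX := continuous_szego_sqr.
have [mX1 mX2] := continuous_cmeasurable cX.
have [mU1 mU2] := mU.
have mXU : cmeasurable (fun t => X t * U t).
  split.
  - rewrite (_ : (fun t => _) = fun t => Re (X t) * Re (U t) - Im (X t) * Im (U t)).
      by apply: measurable_funB; exact: measurable_funM.
    by apply/funext => t; rewrite ReM.
  - rewrite (_ : (fun t => _) = fun t => Re (X t) * Im (U t) + Im (X t) * Re (U t)).
      by apply: measurable_funD; exact: measurable_funM.
    by apply/funext => t; rewrite ImM.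
have XUB t : period t -> normc (X t * U t) <= B.
  move=> _; rewrite normcM; apply: le_trans (szego_sqr_norm_le t).
  by rewrite ler_piMr ?normc_ge0.
have lim1 := cvg_circle_integral_mul mXU XUB cF.
apply: (cvg_seq_unique lim1).
have iXU n : cintegrable (fun t => X t * U t * polar 1 t ^+ n).
  apply: (cintegrable_mul mXU XUB); apply: continuous_cintegrable.
  exact: (continuousXc (n := n) ce).
(* Term [n] is [pairing_shift] for [u] with shift [n]. Its part [n * u w] collects into
   [u w * (w * d)], the rest into the product of [f w] and [(z u)'(w)]. *)
have -> : (fun k => circle_integral (fun t => X t * U t * psum a (N k) t)) =
    (fun k => (\sum_(0 <= n < N k) a n * w ^+ n) * (u w + w * du) +
        u w * \sum_(0 <= n < N k) n%:R * a n * w ^+ n).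
  apply/funext => k; rewrite circle_integral_psum//.
  rewrite mulr_suml mulr_sumr -big_split/=; apply: eq_bigr => n _.
  rewrite (@eq_circle_integral _ _ (fun t => X t * polar 1 t ^+ n * U t)); last first.
    by move=> t; ring.
  by rewrite (pairing_shift n ua kNu cU lu1 lu2); ring.
apply: cvgD; apply: cvgM; do ?[exact: cvg_cst].
- exact: (cvg_subseq kN (af w wd)).
- exact: (cvg_subseq kN l1).
Qed.

End pairings.

(** * Radial limits of products and of the kernel *)

Section boundary_kernel.
Context {R : realType}.
Local Notation mu := (@lebesgue_measure R).
Local Notation period := (`[0 : R, 2 * pi]%classic).

Lemma cvg_polar1 t : polar r t @[r --> (1 : R)^'-] --> (polar 1 t : R[i]).
Proof.
by apply: cvg_complex => /=; apply: cvgM; do ?[exact: cvg_cst];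
  apply: cvg_within; exact: cvg_id.
Qed.

Lemma disk_conj (w : R[i]) : disk w -> disk (w^*).
Proof. by move=> /diskP wd; apply/diskP; rewrite normcJ. Qed.

Lemma cvg_geometric_polar1 (c : R[i]) t : disk c ->
  (1 - c * polar r t)^-1 @[r --> (1 : R)^'-] --> (1 - c * polar 1 t)^-1.
Proof.
move=> cd; apply: cvgV.
  by apply: one_sub_mul_neq0 => //; rewrite normc_polar normr1.
apply: cvgB; first exact: cvg_cst.
by apply: cvgM; [exact: cvg_cst|exact: cvg_polar1].
Qed.

Lemma conj_szego (w : R[i]) t : ((1 - w^* * polar 1 t)^-1)^* = szego w t.
Proof. by rewrite /szego fmorphV rmorphB rmorph1 rmorphM/= conjCK. Qed.

Lemma radial_limits_mul f F g G : radial_limits f F -> radial_limits g G ->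
  radial_limits (fun z => f z * g z) (fun t => F t * G t : R[i]).
Proof.
move=> fF gG; have aeF := ae_filter_ringOfSetsType mu.
apply: (filterS2 _ _ fF gG) => t h1 h2 pt.
by apply: cvgM; [exact: h1|exact: h2].
Qed.

Lemma radial_limits_add f F g G : radial_limits f F -> radial_limits g G ->
  radial_limits (fun z => f z + g z) (fun t => F t + G t : R[i]).
Proof.
move=> fF gG; have aeF := ae_filter_ringOfSetsType mu.
apply: (filterS2 _ _ fF gG) => t h1 h2 pt.
by apply: cvgD; [exact: h1|exact: h2].
Qed.

Lemma radial_limits_cst (k : R[i]) : radial_limits (fun=> k) (fun=> k).
Proof. by apply: aeW => t _; exact: cvg_cst. Qed.

Lemma radial_limits_geometric (c : R[i]) : disk c ->
  radial_limits (fun z => (1 - c * z)^-1) (fun t => (1 - c * polar 1 t)^-1).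
Proof. by move=> cd; apply: aeW => t _; exact: cvg_geometric_polar1. Qed.

(** For [r] close to 1 from the left the point [polar r t] lies in the disk, so values elsewhere
    cannot affect a radial limit. *)
Lemma eq_disk_radial_limits f g (F : R -> R[i]) : (forall z, disk z -> g z = f z) ->
  radial_limits f F -> radial_limits g F.
Proof.
move=> fg fF; have aeF := ae_filter_ringOfSetsType mu.
apply: (filterS _ fF) => t h pt; have {h} := h pt.
apply: cvg_trans; apply: near_eq_cvg; near=> r; apply: esym; apply: fg.
apply: disk_polar; apply/andP; split.
- by near: r; exact: nbhs_left_ge.
- by near: r; exact: nbhs_left_lt.
Unshelve. all: by end_near.
Qed.

(** Trades the boundary values, defined through [lim], for chosen representatives agreeing with them
    almost everywhere on the period. *)
Lemma inner_prod_boundary f F g G :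
  radial_limits f F -> radial_limits g G ->
  inner_prod f g = circle_integral (fun t => F t * (G t)^*) :> R[i].
Proof.
move=> fF gG; apply: circle_integral_ae.
have aeF := ae_filter_ringOfSetsType mu.
apply: (filterS2 _ _ fF gG) => t h1 h2 pt.
by rewrite (boundaryE (h1 pt)) (boundaryE (h2 pt)).
Qed.

End boundary_kernel.

(** Meant for [y = U t], [v] its conjugate, [s = u w] and [X] the conjugate of the boundary value of
    [h]. The relation [y * v = 1] simplifies the terms in [F2], and the last three terms keep a
    factor [v], which orthogonality to [u H^2] kills. *)
Lemma square_pairing_expansion (K : comPzRingType) (F1 F2 X s y v : K) : y * v = 1 ->
  (F1 + y * F2) * ((1 - s * v) ^+ 2 * X) =
  X * F1 + X * (y * F2) + (- 2 * s) * (X * F2) + ((- 2 * s) * (X * (v * F1)) +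
    (s ^+ 2 * (X * (v * (v * F1))) + s ^+ 2 * (X * (v * F2)))).
Proof.
move=> yv.
transitivity (X * F1 + X * (y * F2) + (- 2 * s) * (X * (y * v * F2)) +
  (- 2 * s * (X * (v * F1)) + (s ^+ 2 * (X * (v * (v * F1))) +
   s ^+ 2 * (X * (v * (y * v * F2)))))); first by ring.
by rewrite yv !mul1r.
Qed.

Theorem theorem9 (R : realType) (u f f1 f2 : R[i] -> R[i])
    (hu : inner_function u)
    (hf1 : model_space u f1) (hf2 : model_space u f2)
    (hf : forall z : R[i], disk z -> f z = f1 z + u z * f2 z) :
  forall w : R[i], disk w ->
    T_op u f w = inner_prod f (fun z => model_kernel u w z ^+ 2) /\
    inner_prod f (fun z => model_kernel u w z ^+ 2)
      = derive1 (fun z : R[i] => z * f z) w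
        - 2 * u w * derive1 (fun z : R[i] => z * f2 z) w.
Proof.
move=> w wd; split=> //.
have [hu2 _ _] := hu; have [hf1h orth1] := hf1; have [hf2h orth2] := hf2.
have [au ua] := hardy2_taylor hu2.
have [a1 fa1] := hardy2_taylor hf1h.
have [a2 fa2] := hardy2_taylor hf2h.
have [Nu [U [kNu mU U1 cU radU]]] := inner_boundary hu ua.
have [N1 [F1 [kN1 mF1 cF1 rad1]]] := hardy2_boundary fa1.
have [N2 [F2 [kN2 mF2 cF2 rad2]]] := hardy2_boundary fa2.
have [du [uder _ lu1 lu2]] := taylor_derive1_id ua wd.
have [d1 [f1der _ l11 l12]] := taylor_derive1_id fa1 wd.
have [d2 [f2der f2D l21 l22]] := taylor_derive1_id fa2 wd.
set c := w^*; have cd : disk c := disk_conj wd.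
pose X t := szego w t ^+ 2.
(* Of the two test functions, [h] yields the terms with one conjugate of [U] through [u * h], and
   [uh] the term with two through [u * uh]. *)
pose h z : R[i] := 1 / (1 - c * z) / (1 - c * z).
have hardy_h : hardy2 h := hardy2_geometric cd (hardy2_geometric cd (@hardy2_1 R)).
pose uh z : R[i] := u z / (1 - c * z) / (1 - c * z).
have hardy_uh : hardy2 uh := hardy2_geometric cd (hardy2_geometric cd hu2).
pose g t : R[i] := (1 - c * polar 1 t)^-1.
have gX t : (g t ^+ 2)^* = X t by rewrite rmorphXn/= conj_szego.
have radg := radial_limits_geometric cd.
have rad_h : radial_limits h (fun t => 1 * g t * g t).
  exact: radial_limits_mul (radial_limits_mul (radial_limits_cst 1) radg) radg.
have radu : radial_limits u U.
  have aeF := ae_filter_ringOfSetsType (@lebesgue_measure R).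
  by apply: (filterS _ radU) => t hU pt; case: (hU pt).
have rad_uh : radial_limits uh (fun t => U t * g t * g t).
  exact: radial_limits_mul (radial_limits_mul radu radg) radg.
(* On the disk [f] is [f1 + u * f2], so its radial limits are those of the sum. *)
have radf : radial_limits f (fun t => F1 t + U t * F2 t).
  apply: eq_disk_radial_limits hf _.
  exact: radial_limits_add rad1 (radial_limits_mul radu rad2).
have radk : radial_limits (fun z => model_kernel u w z ^+ 2)
    (fun t => (1 + (- (u w)^*) * U t) * g t * ((1 + (- (u w)^*) * U t) * g t)).
  have rk : radial_limits (fun z => model_kernel u w z)
      (fun t => (1 + (- (u w)^*) * U t) * g t).
    apply: (@eq_disk_radial_limits _ (fun z => (1 + (- (u w)^*) * u z) * (1 - c * z)^-1)).
      by move=> z _; rewrite /model_kernel mulNr.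
    apply: radial_limits_mul radg; apply: radial_limits_add (radial_limits_cst 1) _.
    exact: radial_limits_mul (radial_limits_cst _) radu.
  exact: (radial_limits_mul rk rk).
have [_ iF1 _ _] := cF1; have [_ iF2 _ _] := cF2.
have mX : cmeasurable X by apply: continuous_cmeasurable; exact: continuous_szego_sqr.
have XB t : `[0, 2 * pi]%classic t -> normc (X t) <= (1 - normc w)^-1 ^+ 2.
  by move=> _; exact: szego_sqr_norm_le.
have iX F : cintegrable F -> cintegrable (fun t => X t * F t).
  exact: cintegrable_mul mX XB.
have mUJ : cmeasurable (fun t => (U t)^*).
  have [mU1 mU2] := mU; split.
    by rewrite (_ : (fun t => _) = fun t => Re (U t)) => //; apply/funext => t; rewrite ReJ.
  rewrite (_ : (fun t => _) = fun t => -1 * Im (U t)).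
    by apply: measurable_funM => //; exact: measurable_cst.
  by apply/funext => t; rewrite ImJ mulN1r.
have iUJ F : cintegrable F -> cintegrable (fun t => (U t)^* * F t).
  by apply: (@cintegrable_mul _ _ _ 1) => // t _; rewrite normcJ.
have iU F : cintegrable F -> cintegrable (fun t => U t * F t).
  exact: (@cintegrable_mul _ _ _ 1).
have conj1gg t : (1 * g t * g t)^* = X t by rewrite mul1r -expr2 gX.
have J1 : circle_integral (fun t => X t * ((U t)^* * F1 t)) = 0.
  rewrite -(orth1 h hardy_h) (inner_prod_boundary rad1 (radial_limits_mul radu rad_h)).
  by apply: eq_circle_integral => t; rewrite rmorphM/= conj1gg; ring.
have J3 : circle_integral (fun t => X t * ((U t)^* * F2 t)) = 0.
  rewrite -(orth2 h hardy_h) (inner_prod_boundary rad2 (radial_limits_mul radu rad_h)).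
  by apply: eq_circle_integral => t; rewrite rmorphM/= conj1gg; ring.
have J2 : circle_integral (fun t => X t * ((U t)^* * ((U t)^* * F1 t))) = 0.
  rewrite -(orth1 uh hardy_uh) (inner_prod_boundary rad1 (radial_limits_mul radu rad_uh)).
  apply: eq_circle_integral => t; rewrite -(mulrA (U t) (g t)) -expr2 !rmorphM/= -expr2.
  by rewrite -gX rmorphXn/=; ring.
have I1 : circle_integral (fun t => X t * F1 t) = f1 w + w * d1.
  have := pairing_shift wd 0 fa1 kN1 cF1 l11 l12; rewrite mul1r mul0r addr0 => <-.
  by apply: eq_circle_integral => t; rewrite expr0 mulr1.
have I3 : circle_integral (fun t => X t * F2 t) = f2 w + w * d2.
  have := pairing_shift wd 0 fa2 kN2 cF2 l21 l22; rewrite mul1r mul0r addr0 => <-.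
  by apply: eq_circle_integral => t; rewrite expr0 mulr1.
have I2 : circle_integral (fun t => X t * (U t * F2 t)) =
    f2 w * (u w + w * du) + u w * (w * d2).
  rewrite -(pairing_mul wd fa2 ua kN2 kNu cF2 cU mU U1 l21 lu1 lu2).
  by apply: eq_circle_integral => t; rewrite mulrA.
pose s := u w.
have lhs : inner_prod f (fun z => model_kernel u w z ^+ 2) =
    f1 w + w * d1 + (f2 w * (u w + w * du) + u w * (w * d2)) +
    (- 2 * s) * (f2 w + w * d2).
  rewrite (inner_prod_boundary radf radk).
  transitivity (circle_integral (fun t => X t * F1 t + X t * (U t * F2 t) +
      (- 2 * s) * (X t * F2 t) + ((- 2 * s) * (X t * ((U t)^* * F1 t)) +
      (s ^+ 2 * (X t * ((U t)^* * ((U t)^* * F1 t))) +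
       s ^+ 2 * (X t * ((U t)^* * F2 t)))))).
    (* The expansion holds where [U t] is unimodular, hence almost everywhere on the period. *)
    apply: circle_integral_ae.
    have aeF := ae_filter_ringOfSetsType (@lebesgue_measure R).
    apply: (filterS _ radU) => t hU pt; have [_ /mul_conj_unit UU0] := hU pt.
    have UU : U t * (U t)^* = 1 by exact: UU0.
    have -> : ((1 + - (u w)^* * U t) * g t * ((1 + - (u w)^* * U t) * g t))^* =
        (1 - s * (U t)^*) ^+ 2 * X t.
      rewrite -gX rmorphXn/= !rmorphM/= rmorphD/= rmorphM/= rmorphN/= rmorph1 conjCK /s.
      by ring.
    exact: square_pairing_expansion.
  have iXF1 := iX _ iF1; have iXF2 := iX _ iF2.
  have iXUF2 := iX _ (iU _ iF2).
  have iXJ1 := iX _ (iUJ _ iF1); have iXJ2 := iX _ (iUJ _ (iUJ _ iF1)).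
  have iXJ3 := iX _ (iUJ _ iF2).
  have z3 := cintegrableZ (- 2 * s) iXF2.
  have z4 := cintegrableZ (- 2 * s) iXJ1.
  have z5 := cintegrableZ (s ^+ 2) iXJ2.
  have z6 := cintegrableZ (s ^+ 2) iXJ3.
  have z12 := cintegrableD iXF1 iXUF2.
  rewrite (circle_integralD (cintegrableD z12 z3) (cintegrableD z4 (cintegrableD z5 z6))).
  rewrite (circle_integralD z12 z3) (circle_integralD iXF1 iXUF2).
  rewrite (circle_integralD z4 (cintegrableD z5 z6)) (circle_integralD z5 z6).
  by rewrite !circle_integralZ// I1 I2 I3 J1 J2 J3 !mulr0 !addr0.
(* Product rule for [f1 + u * f2], transferred to [f] because the two agree on a neighbourhood of
   [w]. *)
have fder : is_derive w 1 f (d1 + (u w *: d2 + f2 w *: du)).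
  have h1 := is_deriveD f1der (is_deriveM uder f2der).
  apply: near_eq_is_derive h1.
  have /diskP w1 := wd.
  have : \forall z \near w, `|w - z| < (1 - normc w)%:C%C.
    by have /cvgrPdist_lt := @cvg_id _ (nbhs w); apply; rewrite ltcR subr_gt0.
  apply: filterS => z; rewrite normcE ltcR => wz.
  rewrite hf//; apply/diskP; have := normcB w (w - z).
  by rewrite opprB addrCA subrr addr0; lra.
rewrite lhs f2D derive1E.
have hh := is_deriveM (is_derive_id w 1) fder.
rewrite (@derive_val _ _ _ _ _ _ _ hh) /GRing.scale/= (hf w wd) /s.
by ring.
Qed.
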